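(* Let $F$ be an algebraically closed field of characteristic zero and $G$ a finite group. Let $A$ and $B$ be finite dimensional $G$-graded full algebras over $F$ which are $G$-graded PI-equivalent. Then the maximal semisimple graded subalgebras $A_{ss}$ and $B_{ss}$ are $G$-graded isomorphic.
   Context: For a finite dimensional $G$-graded algebra $A$, let $A\cong A_1\times\cdots\times A_q\oplus J_A$ be its graded Wedderburn–Malcev decomposition, with $A_i$ $G$-graded simple and $J_A$ the Jacobson radical; $A_{ss}=A_1\times\cdots\times A_q$. $A$ is full if, up to a permutation of indices, $A_1\cdot J_A\cdots J_A\cdot A_q\neq0$. $G$-graded PI-equivalent means $\mathrm{Id}_G(A)=\mathrm{Id}_G(B)$. *)

(* Defs.v *)
From HB Require Import structures.
From mathcomp Require Import all_boot all_order all_algebra all_fingroup all_field.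
Set Implicit Arguments. Unset Strict Implicit. Unset Printing Implicit Defensive.
Import GRing.Theory.
Local Open Scope ring_scope.

Section GradedAlgebras.
Variables (F : fieldType) (gT : finGroupType) (V : vectType F).
Variable mul : V -> V -> V.
Variable gr : gT -> {vspace V}.

Definition galg : Prop :=
  [/\ (forall a x y z, mul (a *: x + y) z = a *: mul x z + mul y z),
      (forall a x y z, mul z (a *: x + y) = a *: mul z x + mul z y),
      (forall x y z, mul x (mul y z) = mul (mul x y) z),
      ((\sum_(g : gT) gr g)%VS = fullv /\ directv (\sum_(g : gT) gr g)) &
      (forall g h x y, x \in gr g -> y \in gr h -> mul x y \in gr (g * h)%g)].

Definition graded_sub (S : {vspace V}) : Prop :=
  (S = \sum_(g : gT) (S :&: gr g))%VS.

Definition mul_closed (S : {vspace V}) : Prop :=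
  forall x y, x \in S -> y \in S -> mul x y \in S.

Definition ideal_in (S I : {vspace V}) : Prop :=
  (I <= S)%VS /\ forall x y, x \in S -> y \in I -> mul x y \in I /\ mul y x \in I.

Definition graded_simple_sub (S : {vspace V}) : Prop :=
  [/\ graded_sub S, mul_closed S,
      (exists x y, [/\ x \in S, y \in S & mul x y != 0]) &
      (forall I : {vspace V}, ideal_in S I -> graded_sub I ->
         I = 0%VS \/ I = S)].

Fixpoint nprod (x : nat -> V) (n : nat) : V :=
  match n with 0 => x 0%N | k.+1 => mul (nprod x k) (x n) end.

Definition nilpotent_sub (J : {vspace V}) : Prop :=
  exists n, forall x : nat -> V, (forall k, x k \in J) -> nprod x n = 0.

Definition jacobson_radical (J : {vspace V}) : Prop :=
  [/\ ideal_in fullv J, nilpotent_sub J &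
      forall I : {vspace V}, ideal_in fullv I -> nilpotent_sub I -> (I <= J)%VS].

Definition graded_WM (J : {vspace V}) (q : nat) (Ai : 'I_q -> {vspace V}) : Prop :=
  [/\ jacobson_radical J,
      (forall i, graded_simple_sub (Ai i)),
      (forall i j, i != j -> forall x y, x \in Ai i -> y \in Ai j -> mul x y = 0),
      directv (\sum_(i < q) Ai i) &
      ((\sum_(i < q) Ai i) :&: J = 0)%VS /\
      ((\sum_(i < q) Ai i) + J = fullv)%VS].

Fixpoint altprod (a j : nat -> V) (k : nat) : V :=
  match k with 0 => a 0%N | m.+1 => mul (mul (altprod a j m) (j m)) (a k) end.

(* fullness: up to a permutation s of the indices,
   A_{s 0} J A_{s 1} J ... J A_{s (q-1)} <> 0 *)
Definition full (J : {vspace V}) (q : nat) (Ai : 'I_q -> {vspace V}) : Prop :=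
  exists (s : {perm 'I_q}) (a j : nat -> V),
    [/\ (0 < q)%N, (forall i : 'I_q, a i \in Ai (s i)),
        (forall k, j k \in J) & altprod a j q.-1 != 0].

End GradedAlgebras.

(* Elements of the free (non-unital) G-graded associative algebra
   F<X_G>, X_G = {x_{i,g} | i in nat, g in G}: finite formal linear
   combinations of nonempty words in the graded variables (i, g). *)
Definition gword (gT : finGroupType) := ((nat * gT) * seq (nat * gT))%type.
Definition gpoly (F : fieldType) (gT : finGroupType) := seq (F * gword gT).

Section Identities.
Variables (F : fieldType) (gT : finGroupType) (V : vectType F).
Variable mul : V -> V -> V.
Variable gr : gT -> {vspace V}.

Definition eval_word (s : nat -> gT -> V) (w : gword gT) : V :=
  foldl (fun acc v => mul acc (s v.1 v.2)) (s w.1.1 w.1.2) w.2.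

Definition eval_gpoly (s : nat -> gT -> V) (p : gpoly F gT) : V :=
  \sum_(m <- p) m.1 *: eval_word s m.2.

Definition is_gid (p : gpoly F gT) : Prop :=
  forall s : nat -> gT -> V, (forall i g, s i g \in gr g) -> eval_gpoly s p = 0.
End Identities.

Definition graded_iso (F : fieldType) (gT : finGroupType) (V W : vectType F)
  (mulV : V -> V -> V) (grV : gT -> {vspace V})
  (mulW : W -> W -> W) (grW : gT -> {vspace W})
  (S : {vspace V}) (T : {vspace W}) : Prop :=
  exists f : 'Hom(V, W),
    [/\ (f @: S)%VS = T, (lker f :&: S = 0)%VS,
        (forall x y, x \in S -> y \in S -> f (mulV x y) = mulW (f x) (f y)) &
        (forall g x, x \in (S :&: grV g)%VS -> f x \in grW g)].

(* Main.v *)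
(* Let S be the semisimple part of A, J its radical, and t(x) the trace of the left
   multiplication by x on S.  In characteristic 0 the form t(xy) on S is nondegenerate
   (a nonzero ideal of S contains an idempotent, whose trace is a positive integer), so
   S has graded Casimir operators: for dual homogeneous bases b_l, b^l of S and z in S
   of degree deg b_k, the sum of the b_l z b^k b^l is a multiple of the unit of the
   component containing b_k, and the factor is t(z b^k) up to a nonzero constant.

   Threading these operators through a nonzero product A_1 J A_2 J ... J A_q and
   alternating gives, for every N, a graded polynomial which is multilinear and
   alternating in each of N blocks of variables, and nonzero for suitable values of the
   other variables when every block is a homogeneous basis of S.  Conversely, if a
   polynomial vanishes as soon as the variables of one of N disjoint groups take values
   in S, then all its values lie in J^N.  Comparing both facts for PI-equivalent A and B
   shows that A_ss and B_ss have the same graded dimensions.  Replacing z_k by u z_k in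
   an alternating block and summing over k multiplies the value by t(u) when the block
   lies in S; hence every polynomial relation between the traces t(x_i x_j),
   t(x_i x_j x_l) which holds on A_ss can be turned into an identity of A, and therefore
   holds on B_ss.

   So the traces of tuples in A_ss and those of tuples in B_ss have the same Zariski
   closure.  Both sets are constructible and irreducible, so (by quantifier elimination)
   they share a point with nonzero Gram determinant.  It comes from homogeneous bases
   of A_ss and B_ss with equal traces of double and triple products, which are then the
   bases of isomorphic graded algebras. *)
Require Import Defs.
From HB Require Import structures.
From mathcomp Require Import all_boot all_order all_algebra all_fingroup all_field.
From Stdlib Require Import FunctionalExtensionality Classical.
Set Implicit Arguments. Unset Strict Implicit. Unset Printing Implicit Defensive.
Import GRing.Theory.
Local Open Scope ring_scope.

(** * Traces and alternating sums *)

Section TraceLemmas.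
Variable F : fieldType.

(** In a full-rank factorization [E = C R], idempotency forces [R C = 1], an identity matrix of size
    [\rank E]; then [tr (C R) = tr (R C)]. *)
Lemma mxtrace_idem d (E : 'M[F]_d) :
  E *m E = E -> \tr E = (\rank E)%:R.
Proof.
move=> EE; rewrite -{1}(mulmx_base E) mxtrace_mulC.
suff -> : row_base E *m col_base E = 1%:M by rewrite mxtrace1.
have /row_freeP[X rX] := row_base_free E.
have /row_fullP[Y Yc] := col_base_full E.
have CRE := mulmx_base E; rewrite -{1 2 3}CRE in EE.
move: (col_base E) (row_base E) X Y rX Yc EE {CRE} => C R X Y rX Yc EE.
have := congr1 (fun M => Y *m M *m X) EE.
by rewrite /= !mulmxA Yc mul1mx -!mulmxA rX mulmx1.
Qed.

(** Passing from [E = C R] to [R C] keeps the trace and lowers the nilpotency exponent by one, so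
    the induction on [n] runs over matrices of all sizes. *)
Lemma mxtrace_nilp n d (E : 'M[F]_d) :
  iter n (mulmx E) 1%:M = 0 -> \tr E = 0.
Proof.
elim: n d E => [|n IH] d E /= H.
  by rewrite -[E]mulmx1 H mulmx0 mxtrace0.
rewrite -(mulmx_base E) mxtrace_mulC; apply: IH.
have /row_freeP[X rX] := row_base_free E.
have /row_fullP[Y Yc] := col_base_full E.
have ER := mulmx_base E.
move: (col_base E) (row_base E) X Y rX Yc ER => C R X Y rX Yc ER.
have it k : E *m iter k (mulmx E) 1%:M = C *m iter k (mulmx (R *m C)) 1%:M *m R.
  elim: k => [|k IHk] /=; first by rewrite !mulmx1 ER.
  by rewrite IHk -{1}ER !mulmxA.
have := congr1 (fun M => Y *m M *m X) H; rewrite /= it !mulmxA Yc mul1mx -mulmxA rX.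
by rewrite mulmx1 mulmx0 mul0mx.
Qed.

(** Expansion along the replaced row only meets cofactors of [C], so the sum is the trace of
    [C U adj(C)]. This is what turns alternation into traces. *)
Lemma sum_det_replace_row d (C U : 'M[F]_d) :
  \sum_k \det (\matrix_(i, j) if i == k then (C *m U) i j else C i j)
    = \tr U * \det C.
Proof.
have -> : \tr U * \det C = \tr (C *m U *m \adj C).
  rewrite -mulmxA mxtrace_mulC -mulmxA mul_adj_mx -[RHS]/(\tr (U *m _)).
  by rewrite mul_mx_scalar mxtraceZ mulrC.
apply: eq_bigr => k _; rewrite (expand_det_row _ k) mxE; apply: eq_bigr => j _.
rewrite !mxE eqxx; congr (_ * _); rewrite /cofactor; congr (_ * \det _).
by apply/matrixP=> i l; rewrite !mxE eq_sym (negPf (neq_lift _ _)).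
Qed.

End TraceLemmas.

Section Alternation.
Variables (F : fieldType) (T W : lmodType F) (I : finType).

Definition upd (X : Type) (z : I -> X) k x := fun i => if i == k then x else z i.

Definition multilinear (f : (I -> T) -> W) := forall k z a x y,
  f (upd z k (a *: x + y)) = a *: f (upd z k x) + f (upd z k y).

Lemma upd_id (X : Type) (z : I -> X) k : upd z k (z k) = z.
Proof. by apply: functional_extensionality => i; rewrite /upd; case: eqP => // ->. Qed.

Lemma upd_upd (X : Type) (z : I -> X) k x y : upd (upd z k x) k y = upd z k y.
Proof. by apply: functional_extensionality => i; rewrite /upd; case: eqP. Qed.

Lemma upd_eq (X : Type) (z : I -> X) k x : upd z k x k = x.
Proof. by rewrite /upd eqxx. Qed.

Lemma multilinear_sum f (J : Type) (r : seq J) (c : J -> F) (e : J -> T) k z :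
  multilinear f ->
  f (upd z k (\sum_(l <- r) c l *: e l)) = \sum_(l <- r) c l *: f (upd z k (e l)).
Proof.
move=> mf; elim: r => [|l r IH]; last by rewrite !big_cons mf IH.
have := mf k z 1 0 0; rewrite !big_nil scaler0 addr0 scale1r.
by rewrite -[X in X = _]addr0 => /addrI <-.
Qed.

Lemma multilinear_expand f (c : I -> I -> F) (e : I -> T) :
  multilinear f ->
  f (fun k => \sum_l c k l *: e l) =
  \sum_(tau : {ffun I -> I}) (\prod_k c k (tau k)) *: f (fun k => e (tau k)).
Proof.
move=> mf.
(* [P s tau] says that [tau] is the identity outside [s]. Such [tau] encode the functions from [s]
   to [I], so induction on [s] expands one argument at a time. *)
pose P (s : seq I) (tau : {ffun I -> I}) := [forall k, (k \in s) || (tau k == k)].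
suff H s w : uniq s ->
    f (fun k => if k \in s then \sum_l c k l *: e l else w k) =
    \sum_(tau | P s tau)
      (\prod_(k <- s) c k (tau k)) *: f (fun k => if k \in s then e (tau k) else w k).
  have := H (enum I) (fun=> 0) (enum_uniq _).
  rewrite (_ : (fun k => _) = fun k => \sum_l c k l *: e l); last first.
    by apply: functional_extensionality => k; rewrite mem_enum.
  move=> ->; apply: eq_big => [tau|tau _].
    by apply/forallP=> k; rewrite mem_enum.
  rewrite big_enum; congr (_ *: f _).
  by apply: functional_extensionality => k; rewrite mem_enum.
elim: s w => [|a s IH] w /=.
  move=> _; rewrite (big_pred1 [ffun k => k]) ?big_nil ?scale1r //.
  move=> tau; apply/forallP/eqP => [E|-> k]; last by rewrite ffunE eqxx orbT.
  by apply/ffunP=> k; rewrite ffunE; apply/eqP; exact: E k.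
case/andP=> as_ us.
rewrite (_ : (fun k => _) = upd (fun k => if k \in s then \sum_l c k l *: e l else w k)
   a (\sum_l c a l *: e l)); last first.
  apply: functional_extensionality => k; rewrite /upd inE.
  by case: eqP => // ->.
rewrite multilinear_sum //.
rewrite (partition_big (fun tau : {ffun I -> I} => tau a) predT) //=.
apply: eq_bigr => l _.
rewrite (_ : upd _ a (e l) =
   (fun k => if k \in s then \sum_l c k l *: e l else upd w a (e l) k)); last first.
  apply: functional_extensionality => k; rewrite /upd.
  by case: (k =P a) => // ->; rewrite (negPf as_).
rewrite IH // scaler_sumr.
pose up (tau : {ffun I -> I}) l' := [ffun k => if k == a then l' else tau k].
rewrite [RHS](reindex_onto (up ^~ l) (up ^~ a)) /=; last first.
  move=> tau /andP[_ /eqP tl]; apply/ffunP=> k; rewrite !ffunE.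
  by case: eqP => // ->.
apply: eq_big => [tau|tau Pt].
  rewrite [up tau l a]ffunE !eqxx andbT.
  apply/forallP/andP => [E|[/forallP E /eqP E2] k].
    split.
      apply/forallP=> k; rewrite inE ffunE.
      by case: eqP => //= _; apply: E.
    apply/eqP/ffunP=> k; rewrite !ffunE; case: eqP => // ->.
    by apply/esym/eqP; have := E a; rewrite (negPf as_).
  have := E k; rewrite inE ffunE; case: eqP => //= -> _.
  by have := congr1 (fun t : {ffun I -> I} => t a) E2; rewrite !ffunE eqxx => <-; rewrite eqxx orbT.
have Es k : k \in s -> up tau l k = tau k.
  by move=> ks; rewrite ffunE; case: eqP ks as_ => // -> ->.
rewrite big_cons ffunE eqxx scalerA; congr (_ * _ *: f _).
  by rewrite !big_seq; apply: eq_bigr => k ks; rewrite Es.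
apply: functional_extensionality => k; rewrite inE ffunE /upd.
case: eqP => [->|] //; by rewrite (negPf as_).
Qed.
End Alternation.

Section DegreeAlternation.
Variables (F : fieldType) (T W : lmodType F) (G : eqType) (d : nat) (g : 'I_d -> G).

Definition pres (s : {ffun 'I_d -> 'I_d}) := [forall k, g (s k) == g k].

(** Only permutations preserving the degrees [g] occur, since a graded polynomial must keep each
    variable in its own degree. *)
Definition altsum (f : ('I_d -> T) -> W) (z : 'I_d -> T) : W :=
  \sum_(s : 'S_d | pres (pval s)) (-1) ^+ s *: f (fun k => z (s k)).

(** After full expansion, the coefficient of [f (z o tau)] is a sum over degree-preserving
    permutations. As [c] is block diagonal for the degrees, the missing permutations would
    contribute 0, so the sum is a genuine determinant if [tau] preserves degrees; it is 0 otherwise,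
    and also when [tau] is not injective. *)
Lemma altsum_det f (c : 'M[F]_d) z : multilinear f ->
  (forall k l, g k != g l -> c k l = 0) ->
  altsum f (fun k => \sum_l c k l *: z l) = \det c *: altsum f z.
Proof.
move=> mf cg; rewrite /altsum.
under eq_bigr => s _ do
  rewrite (multilinear_expand (fun k l => c (s k) l)) // scaler_sumr.
rewrite exchange_big /=.
pose D (tau : {ffun 'I_d -> 'I_d}) := \det (\matrix_(k, m) c m (tau k)).
have DE (tau : {ffun 'I_d -> 'I_d}) : \sum_(s : 'S_d | pres (pval s)) (-1) ^+ s *
     (\prod_k c (s k) (tau k)) = if pres tau then D tau else 0.
  case: ifP => pt.
    rewrite /D /determinant [RHS](bigID (fun s : 'S_d => pres (pval s))) /= [X in _ + X]big1.
      by rewrite addr0; apply: eq_bigr => s _; congr (_ * _); apply: eq_bigr => k _; rewrite mxE.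
    move=> s /=; rewrite negb_forall => /existsP[k nk].
    rewrite (bigD1 k) //= mxE cg ?mul0r ?mulr0 //.
    by move: nk; rewrite pvalE (eqP (forallP pt k)).
  move/negbT: pt; rewrite negb_forall => /existsP[k nk].
  rewrite big1 // => s ps; rewrite (bigD1 k) //= cg ?mul0r ?mulr0 //.
  by have /eqP := forallP ps k; rewrite pvalE => ->; rewrite eq_sym.
under eq_bigr => tau _.
  under eq_bigr do rewrite scalerA.
  rewrite -scaler_suml DE.
  over.
rewrite (bigID (fun tau : {ffun 'I_d -> 'I_d} => injectiveb tau)) /= [X in _ + X]big1 ?addr0; last first.
  move=> tau /injectivePn[i [j nij tij]]; case: ifP => _; last by rewrite scale0r.
  rewrite /D (determinant_alternate nij) ?scale0r // => m.
  by rewrite !mxE tij.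
rewrite (reindex (fun s : 'S_d => pval s)) /=; last first.
  pose in_Sn := insubd (1%g : 'S_d).
  by exists in_Sn => /= f0 Uf; first apply: val_inj; apply: insubdK.
rewrite scaler_sumr [RHS]big_mkcond /=.
apply: eq_big => [s|s _]; first by rewrite (valP s).
case: ifP => ps; last by rewrite scale0r.
rewrite scalerA pvalE; congr (_ *: _).
have -> : D (pval s) = \det (row_perm s c^T).
  by congr (\det _); apply/matrixP=> i j; rewrite !mxE pvalE.
by rewrite row_permE det_mulmx det_perm det_tr mulrC.
Qed.

End DegreeAlternation.

(** * Graded algebras and homogeneous bases *)

Section GradedAlgebra.
Variables (F : fieldType) (gT : finGroupType) (V : vectType F).
Variables (mul : V -> V -> V) (gr : gT -> {vspace V}).
Hypothesis galgV : galg mul gr.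
Implicit Types (M : {vspace V}) (x y z : V).

Lemma mulvA x y z : mul x (mul y z) = mul (mul x y) z.
Proof. by case: galgV. Qed.

Lemma mulPl a x y z : mul (a *: x + y) z = a *: mul x z + mul y z.
Proof. by case: galgV. Qed.

Lemma mulPr a x y z : mul z (a *: x + y) = a *: mul z x + mul z y.
Proof. by case: galgV. Qed.

Lemma mul_gr g h x y : x \in gr g -> y \in gr h -> mul x y \in gr (g * h)%g.
Proof. by case: galgV => _ _ _ _; apply. Qed.

Lemma mul0v x : mul 0 x = 0.
Proof.
have := mulPl 1 0 0 x; rewrite !scale1r addr0 -{1}[mul 0 x]addr0.
by move/addrI => <-.
Qed.

Lemma mulv0 x : mul x 0 = 0.
Proof.
have := mulPr 1 0 0 x; rewrite !scale1r addr0 -{1}[mul x 0]addr0.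
by move/addrI => <-.
Qed.

Lemma mulvDl x y z : mul (x + y) z = mul x z + mul y z.
Proof. by have := mulPl 1 x y z; rewrite !scale1r. Qed.

Lemma mulvDr x y z : mul z (x + y) = mul z x + mul z y.
Proof. by have := mulPr 1 x y z; rewrite !scale1r. Qed.

Lemma mulvZl a x z : mul (a *: x) z = a *: mul x z.
Proof. by have := mulPl a x 0 z; rewrite mul0v !addr0. Qed.

Lemma mulvZr a x z : mul z (a *: x) = a *: mul z x.
Proof. by have := mulPr a x 0 z; rewrite mulv0 !addr0. Qed.

Lemma mulvNl x z : mul (- x) z = - mul x z.
Proof. by rewrite -scaleN1r mulvZl scaleN1r. Qed.

Lemma mulv_suml (I : Type) (r : seq I) (P : pred I) f z :
  mul (\sum_(i <- r | P i) f i) z = \sum_(i <- r | P i) mul (f i) z.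
Proof. by apply: (big_morph (mul ^~ z)) => [x y|]; rewrite ?mulvDl ?mul0v. Qed.

Lemma mulv_sumr (I : Type) (r : seq I) (P : pred I) f z :
  mul z (\sum_(i <- r | P i) f i) = \sum_(i <- r | P i) mul z (f i).
Proof. by apply: (big_morph (mul z)) => [x y|]; rewrite ?mulvDr ?mulv0. Qed.

Lemma gr_direct : directv (\sum_g gr g).
Proof. by case: galgV => _ _ _ []. Qed.

Lemma gr_full : (\sum_g gr g)%VS = fullv.
Proof. by case: galgV => _ _ _ []. Qed.

Lemma graded_subP M x : graded_sub gr M -> x \in M ->
  exists2 c : gT -> V, (forall g, c g \in (M :&: gr g)%VS) & x = \sum_g c g.
Proof. by move=> gM; rewrite {1}gM => /memv_sumP[c cM ->]; exists c => // g; apply: cM. Qed.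

Lemma graded_subI M :
  (forall x, x \in M -> exists2 c : gT -> V,
      (forall g, c g \in (M :&: gr g)%VS) & x = \sum_g c g) -> graded_sub gr M.
Proof.
move=> H; apply/eqP; rewrite eqEsubv; apply/andP; split.
  by apply/subvP=> x /H[c cM ->]; apply: memv_sumr.
by apply/subv_sumP=> g _; apply: capvSl.
Qed.

Lemma graded_sub_sum (I : finType) (M : I -> {vspace V}) :
  (forall i, graded_sub gr (M i)) -> graded_sub gr (\sum_i M i)%VS.
Proof.
move=> gM; apply: graded_subI => x /memv_sumP[c cM ->].
have ex i : exists u : {ffun gT -> V}, [forall g, u g \in (M i :&: gr g)%VS] && (c i == \sum_g u g).
  have [u uM ->] := graded_subP (gM i) (cM i isT); exists (finfun u).
  by apply/andP; split; [apply/forallP=> g; rewrite ffunE | apply/eqP/eq_bigr => g _; rewrite ffunE].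
pose u i := xchoose (ex i).
have uP i : (forall g, u i g \in (M i :&: gr g)%VS) /\ c i = \sum_g u i g.
  by have /andP[/forallP ? /eqP] := xchooseP (ex i).
exists (fun g => \sum_i u i g) => [g|].
  rewrite memv_cap memv_sumr ?memv_suml // => i _.
    by have /memv_capP[] := (uP i).1 g.
  by have /memv_capP[] := (uP i).1 g.
by rewrite exchange_big /=; apply: eq_bigr => i _; apply: (uP i).2.
Qed.

Lemma cap_gr_direct M : directv (\sum_g (M :&: gr g)).
Proof.
apply/directv_sum_independent => u uM; move/directv_sum_independent: gr_direct; apply.
by move=> g _; have /memv_capP[] := uM g isT.
Qed.

Lemma graded_subP_gr x h (c : gT -> V) :
  (forall g, c g \in gr g) -> x \in gr h -> x = \sum_g c g -> x = c h.
Proof.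
move=> cg xh E; pose u g := c g - (if g == h then x else 0).
move/directv_sum_independent: gr_direct => /(_ u) H.
have /eqP : u h = 0.
  apply: H => // [g _|].
    by rewrite memvB //; case: eqP => [->|_] //; apply: mem0v.
  by rewrite sumrB -big_mkcond big_pred1_eq -E subrr.
by rewrite /u eqxx subr_eq0 => /eqP.
Qed.

Section HomBasis.
Variables (M : {vspace V}) (d : nat).

Definition hbasis (g : 'I_d -> gT) (e : 'I_d -> V) :=
  (forall k, e k \in gr (g k)) /\ basis_of M [tuple e k | k < d].

Definition cf (e : 'I_d -> V) k x := coord [tuple e k | k < d] k x.

Lemma cfP e k a x y : cf e k (a *: x + y) = a * cf e k x + cf e k y.
Proof. by rewrite /cf linearP. Qed.

Lemma cf_sum (I : Type) (r : seq I) (P : pred I) e k (a : I -> F) f :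
  cf e k (\sum_(i <- r | P i) a i *: f i) = \sum_(i <- r | P i) a i * cf e k (f i).
Proof. by rewrite /cf linear_sum; apply: eq_bigr => i _; rewrite linearZ. Qed.

Variables (g : 'I_d -> gT) (e : 'I_d -> V).
Hypothesis hb : hbasis g e.

Lemma hb_gr k : e k \in gr (g k).
Proof. exact: hb.1. Qed.

Lemma hb_mem k : e k \in M.
Proof.
by apply: (basis_mem hb.2); apply/tnthP; exists k; rewrite tnth_mktuple.
Qed.

Lemma hb_expand x : x \in M -> x = \sum_k cf e k x *: e k.
Proof.
move=> xM; rewrite {1}(coord_basis hb.2 xM); apply: eq_bigr => k _.
by rewrite (nth_map k) ?size_enum_ord // nth_ord_enum.
Qed.

Lemma hb_cf a k : cf e k (\sum_l a l *: e l) = a k.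
Proof.
rewrite -[RHS](coord_sum_free a k (basis_free hb.2)); congr (coord _ _ _).
by apply: eq_bigr => l _; rewrite (nth_map l) ?size_enum_ord // nth_ord_enum.
Qed.

Lemma hb_cf_e k l : cf e k (e l) = (k == l)%:R.
Proof.
have := hb_cf (fun i => (i == l)%:R) k; rewrite (bigD1 l) //= eqxx scale1r.
by rewrite big1 ?addr0 // => i /negPf ->; rewrite scale0r.
Qed.

Lemma hb_supp x h k : x \in M -> x \in gr h -> g k != h -> cf e k x = 0.
Proof.
move=> xM xh gk; pose c h' := \sum_(l | g l == h') cf e l x *: e l.
have cg h' : c h' \in gr h'.
  by apply: memv_suml => l /eqP <-; rewrite memvZ ?hb_gr.
have E : x = \sum_h' c h'.
  by rewrite {1}(hb_expand xM) (partition_big g predT).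
rewrite (graded_subP_gr cg xh E) /c cf_sum big1 // => l /eqP gl.
by rewrite hb_cf_e; case: (k =P l) gk => [->|_ _]; rewrite ?gl ?eqxx ?mulr0.
Qed.

(** Left multiplication in the row-vector convention: row [k] is the image of [e k], hence products
    are reversed in [reg_mul]. *)
Definition reg x := \matrix_(k, l) cf e l (mul x (e k)).
Definition tr x := \sum_k cf e k (mul x (e k)).

Lemma trE x : tr x = \tr (reg x).
Proof. by apply: eq_bigr => k _; rewrite mxE. Qed.

Lemma trP a x y : tr (a *: x + y) = a * tr x + tr y.
Proof. by rewrite /tr mulr_sumr -big_split; apply: eq_bigr => k _; rewrite mulPl cfP. Qed.

Lemma tr0 : tr 0 = 0.
Proof. by rewrite /tr big1 // => k _; rewrite mul0v /cf linear0. Qed.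

Lemma trD x y : tr (x + y) = tr x + tr y.
Proof. by have := trP 1 x y; rewrite scale1r mul1r. Qed.

Lemma trZ a x : tr (a *: x) = a * tr x.
Proof. by have := trP a x 0; rewrite tr0 !addr0. Qed.

Lemma tr_sum (I : Type) (r : seq I) (P : pred I) f :
  tr (\sum_(i <- r | P i) f i) = \sum_(i <- r | P i) tr (f i).
Proof. by apply: big_morph => [x y|]; rewrite ?trD ?tr0. Qed.

Definition stab x := forall y, y \in M -> mul x y \in M.

Lemma reg_expand x k : stab x -> mul x (e k) = \sum_l reg x k l *: e l.
Proof.
move=> sx; rewrite {1}(hb_expand (sx _ (hb_mem k))).
by apply: eq_bigr => l _; rewrite mxE.
Qed.

Lemma reg_mul x y : stab y -> reg (mul x y) = reg y *m reg x.
Proof.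
move=> sy; apply/matrixP=> k l; rewrite mxE -mulvA (reg_expand _ sy) mulv_sumr.
under eq_bigr do rewrite mulvZr.
by rewrite cf_sum mxE; apply: eq_bigr => m _; rewrite [reg x _ _]mxE.
Qed.

Lemma tr_mulC x y : stab x -> stab y -> tr (mul x y) = tr (mul y x).
Proof. by move=> sx sy; rewrite !trE !reg_mul // mxtrace_mulC. Qed.

(** Left multiplication by [x] moves every homogeneous basis vector to another degree, so its matrix
    has zero diagonal. *)
Lemma tr_deg x h : stab x -> x \in gr h -> h != 1%g -> tr x = 0.
Proof.
move=> sx xh h1; apply: big1 => k _.
apply: (hb_supp (h := (h * g k)%g)); [exact/sx/hb_mem | exact: mul_gr (hb_gr k)|].
by apply: contra h1 => /eqP/esym/(canRL (mulgK _)); rewrite mulgV => ->.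
Qed.

Lemma tr_nilp x n : stab x -> (forall y, y \in M -> iter n (mul x) y = 0) -> tr x = 0.
Proof.
move=> sx nx; rewrite trE; apply: (@mxtrace_nilp _ n).
have it k : iter n (mul x) (e k) = \sum_l iter n (mulmx (reg x)) 1%:M k l *: e l.
  elim: n k {nx} => [|n IH] k.
    rewrite (bigD1 k) //= mxE eqxx scale1r big1 ?addr0 // => l.
    by rewrite eq_sym mxE => /negPf ->; rewrite scale0r.
  rewrite iterSr (reg_expand _ sx).
  have it0 : iter n (mul x) 0 = 0 by elim: n {IH} => //= n ->; rewrite mulv0.
  have itD u v : iter n (mul x) (u + v) = iter n (mul x) u + iter n (mul x) v.
    by elim: n {IH it0} => //= n ->; rewrite mulvDr.
  have itZ a u : iter n (mul x) (a *: u) = a *: iter n (mul x) u.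
    by elim: n {IH it0 itD} => //= n ->; rewrite mulvZr.
  rewrite (big_morph _ itD it0).
  under eq_bigr do rewrite itZ IH scaler_sumr.
  rewrite exchange_big /=; apply: eq_bigr => l _; rewrite mxE scaler_suml.
  by apply: eq_bigr => m _; rewrite scalerA.
apply/matrixP=> k l; rewrite [RHS]mxE -[LHS](hb_cf (iter n (mulmx (reg x)) 1%:M k)).
by rewrite -it nx ?hb_mem // /cf linear0.
Qed.

Lemma tr_idem x y : stab x -> mul x x = x -> y \in M -> mul x y != 0 ->
  exists2 r, (0 < r)%N & tr x = r%:R.
Proof.
move=> sx xx yM xy; exists (\rank (reg x)); last first.
  by rewrite trE mxtrace_idem // -reg_mul // xx.
rewrite lt0n mxrank_eq0; apply: contra xy => /eqP r0.
rewrite (hb_expand yM) mulv_sumr big1 // => k _.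
rewrite mulvZr reg_expand // big1 ?scaler0 // => l _.
by rewrite r0 mxE scale0r.
Qed.

End HomBasis.

(** [P] carries extra information on the basis vectors along; [hbasis_sum] uses it to record the
    summand that contains each vector. *)
Lemma hbasis_of_seq M (X : seq V) (P : gT -> V -> Prop) : basis_of M X ->
  (forall x, x \in X -> exists2 g, x \in gr g & P g x) ->
  exists d (g : 'I_d -> gT) (e : 'I_d -> V), hbasis M g e /\ (forall k, P (g k) (e k)).
Proof.
move=> bX hX.
have ex (k : 'I_(size X)) : exists g, X`_k \in gr g /\ P g X`_k.
  by have [g] := hX _ (mem_nth 0 (ltn_ord k)); exists g.
have [g gP] := fin_all_exists ex.
exists (size X), g, (fun k => X`_k); split => [|k]; last exact: (gP k).2.
split => [k|]; first exact: (gP k).1.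
rewrite (_ : tval [tuple X`_k | k < size X] = X) //.
by rewrite /= -[X in map _ _ = X](mkseq_nth 0) /mkseq -val_enum_ord -map_comp.
Qed.

Lemma hbasis_exists M : graded_sub gr M ->
  exists d (g : 'I_d -> gT) (e : 'I_d -> V), hbasis M g e.
Proof.
move=> gM.
have bM : basis_of M (\big[cat/[::]]_g vbasis (M :&: gr g)).
  rewrite {1}gM; apply: bigcat_basis => [|g _]; [exact: cap_gr_direct | exact: vbasisP].
have [|d [g [e []]]] := @hbasis_of_seq M _ (fun _ _ => True) bM; last by exists d, g, e.
move=> x; elim/big_rec: _ => // g y _ IH; rewrite mem_cat => /orP[|//].
by move/vbasis_mem/memv_capP => [_ xg]; exists g.
Qed.

Lemma hbasis_sum (q : nat) (M : 'I_q -> {vspace V}) :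
  (forall i, graded_sub gr (M i)) -> directv (\sum_i M i) ->
  exists d (g : 'I_d -> gT) (e : 'I_d -> V) (ix : 'I_d -> 'I_q),
    hbasis (\sum_i M i) g e /\ (forall k, e k \in M (ix k)).
Proof.
move=> gM dM.
pose X i := \big[cat/[::]]_g vbasis (M i :&: gr g).
have bM : basis_of (\sum_i M i)%VS (\big[cat/[::]]_i X i).
  apply: bigcat_basis => // i _; rewrite {1}gM.
  by apply: bigcat_basis => [|g _]; [exact: cap_gr_direct | exact: vbasisP].
have [|d [g [e [hb eM]]]] := @hbasis_of_seq _ _ (fun _ x => exists i, x \in M i) bM.
  move=> x; elim/big_rec: _ => // i y _ IH; rewrite mem_cat => /orP[|//].
  rewrite /X; elim/big_rec: _ => // g z _ IHz; rewrite mem_cat => /orP[|//].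
  by move/vbasis_mem/memv_capP => [xi xg]; exists g => //; exists i.
have [ix ixP] := fin_all_exists eM.
by exists d, g, e, ix.
Qed.

End GradedAlgebra.

(** * Trace forms, units and Casimir elements of the semisimple part *)

Lemma linear_lfun (F : fieldType) (V W : vectType F) (f : V -> W) :
  (forall a x y, f (a *: x + y) = a *: f x + f y) ->
  exists phi : 'Hom(V, W), forall x, phi x = f x.
Proof.
move=> lf; pose fl : {linear V -> W} := HB.pack f (GRing.isLinear.Build F V W _ f lf).
by exists (linfun fl) => x; rewrite lfunE.
Qed.

Lemma minimal_vspace (F : fieldType) (V : vectType F) (P : {vspace V} -> Prop) M :
  P M -> exists2 L, P L & forall L', P L' -> (L' <= L)%VS -> L' = L.
Proof.
have [n] := ubnP (\dim M); elim: n M => // n IH M ltn PM.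
have [H|/not_all_ex_not[L]] := classic (forall L', P L' -> (L' <= M)%VS -> L' = M).
  by exists M.
move=> HL; have [PL HL'] := imply_to_and _ _ HL; have [LM neq] := imply_to_and _ _ HL'.
apply: (IH L) => //.
rewrite ltnS in ltn; apply: leq_trans ltn; rewrite ltn_neqAle dimvS // andbT.
apply/eqP => dE; apply: neq; apply/eqP.
by rewrite eqEdim LM dE leqnn.
Qed.

Section Products.
Variables (F : fieldType) (gT : finGroupType) (V : vectType F).
Variables (mul : V -> V -> V) (gr : gT -> {vspace V}).
Hypothesis galgV : galg mul gr.
Implicit Types (M K L U W J : {vspace V}) (x y z : V).

Definition prodV U W := <<[seq mul a b | a <- vbasis U, b <- vbasis W]>>%VS.

Lemma mem_prodV U W a b : a \in U -> b \in W -> mul a b \in prodV U W.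
Proof.
move=> aU bW; rewrite (coord_vbasis aU) (mulv_suml galgV); apply: memv_suml => i _.
rewrite (mulvZl galgV) memvZ // (coord_vbasis bW) (mulv_sumr galgV).
apply: memv_suml => j _; rewrite (mulvZr galgV) memvZ // memv_span //.
by apply: allpairs_f; apply: mem_nth; rewrite size_tuple.
Qed.

Lemma prodV_ind U W (P : V -> Prop) : P 0 -> (forall a x y, P x -> P y -> P (a *: x + y)) ->
  (forall a b, a \in U -> b \in W -> P (mul a b)) -> forall x, x \in prodV U W -> P x.
Proof.
move=> P0 PD PM x; rewrite /prodV span_def.
set X := [seq mul a b | a <- vbasis U, b <- vbasis W].
have : {in X, forall y, P y}.
  by move=> y /allpairsP[[a b] [/vbasis_mem aU /vbasis_mem bW ->]]; apply: PM.
elim: X x => [|y s IH] x Ps; first by rewrite big_nil memv0 => /eqP ->.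
rewrite big_cons => /memv_addP[u /vlineP[a ->] [w ws ->]].
apply: PD; first by apply: Ps; rewrite mem_head.
by apply: IH ws => z zs; apply: Ps; rewrite inE zs orbT.
Qed.

Lemma eq_nprod (x y : nat -> V) n : (forall k, (k <= n)%N -> x k = y k) ->
  nprod mul x n = nprod mul y n.
Proof.
elim: n => [|n IH] H /=; first exact: H.
by rewrite IH ?H // => k kn; apply: H; apply: leqW.
Qed.

(** [nprod] at index [n] has [n + 1] factors, so these are [2n + 2] factors grouped in pairs. It
    serves when products of two elements fall into the radical. *)
Lemma nprod_double (x : nat -> V) n :
  nprod mul x n.*2.+1 = nprod mul (fun k => mul (x k.*2) (x k.*2.+1)) n.
Proof. by elim: n => //= n <-; rewrite -(mulvA galgV). Qed.

End Products.

Section WedderburnMalcev.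
Variables (F : closedFieldType) (gT : finGroupType) (V : vectType F).
Hypothesis charF : [pchar F] =i pred0.
Variables (mul : V -> V -> V) (gr : gT -> {vspace V}).
Hypothesis galgV : galg mul gr.
Variables (J : {vspace V}) (q : nat) (Ai : 'I_q -> {vspace V}).
Hypothesis WM : graded_WM mul gr J Ai.
Implicit Types (M K L I : {vspace V}) (x y z : V).

Let mulA := mulvA galgV.
Let S := (\sum_(i < q) Ai i)%VS.

Lemma natf_neq0 n : (0 < n)%N -> n%:R != 0 :> F.
Proof. by rewrite lt0n -(pcharf0P F).1. Qed.

Lemma Ai_sub i : (Ai i <= S)%VS.
Proof. exact: sumv_sup (subvv _). Qed.

Lemma Ai_mul i x y : x \in Ai i -> y \in Ai i -> mul x y \in Ai i.
Proof. by case: WM => _ /(_ i)[_ H _ _] _ _ _; apply: H. Qed.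

Lemma Ai_graded i : graded_sub gr (Ai i).
Proof. by case: WM => _ /(_ i)[]. Qed.

Lemma Ai_orth i j x y : i != j -> x \in Ai i -> y \in Ai j -> mul x y = 0.
Proof. by case: WM => _ _ H _ _ ij; apply: H. Qed.

Lemma S_graded : graded_sub gr S.
Proof. exact: graded_sub_sum Ai_graded. Qed.

Lemma Ai_mulSr i x y : x \in Ai i -> y \in S -> mul x y \in Ai i.
Proof.
move=> xA /memv_sumP[u uA ->]; rewrite (mulv_sumr galgV) (bigD1 i) //= big1 ?addr0.
  by rewrite Ai_mul ?uA.
by move=> j ij; apply: (Ai_orth _ xA (uA j isT)); rewrite eq_sym.
Qed.

Lemma Ai_mulSl i x y : x \in Ai i -> y \in S -> mul y x \in Ai i.
Proof.
move=> xA /memv_sumP[u uA ->]; rewrite (mulv_suml galgV) (bigD1 i) //= big1 ?addr0.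
  by rewrite Ai_mul ?uA.
by move=> j ij; apply: (Ai_orth _ (uA j isT) xA).
Qed.

Lemma S_mul x y : x \in S -> y \in S -> mul x y \in S.
Proof.
move=> /memv_sumP[u uA ->] yS; rewrite (mulv_suml galgV); apply: memv_suml => i _.
by apply: (subvP (Ai_sub i)); rewrite Ai_mulSr ?uA.
Qed.

Lemma J_mul x y : y \in J -> mul x y \in J /\ mul y x \in J.
Proof. by case: WM => [[[_ H] _ _] _ _ _ _]; apply: H; apply: memvf. Qed.

Lemma SJ_split v : exists2 s, s \in S & v - s \in J.
Proof.
case: WM => _ _ _ _ [_ SJ].
have := memvf v; rewrite -SJ => /memv_addP[s sS [j jJ ->]].
by exists s => //; rewrite [s + j]addrC addrK.
Qed.

Lemma SJ_eq0 x : x \in S -> x \in J -> x = 0.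
Proof.
case: WM => _ _ _ _ [SJ _] xS xJ; apply/eqP.
by rewrite -memv0 -SJ memv_cap xS.
Qed.

(** Since [A = S + J], the space [K + J] is an ideal of [A]. Products of two of its elements lie in
    [J], so it is nilpotent and contained in [J]; hence [K] lies in the intersection of [S] and [J],
    which is 0. *)
Lemma square_zero_ideal K : ideal_in mul S K ->
  (forall x y, x \in K -> y \in K -> mul x y = 0) -> K = 0%VS.
Proof.
move=> [KS Kid] K2; apply/eqP; rewrite -subv0; apply/subvP=> k kK.
rewrite memv0; apply/eqP/SJ_eq0; first exact: (subvP KS).
case: WM => [[_ [n nJ] maxJ] _ _ _ _].
suff /subvP H : (K + J <= J)%VS by apply: H; apply: (subvP (addvSl K J)).
apply: maxJ.
  split=> [|x y _ /memv_addP[u uK [v vJ ->]]]; first exact: subvf.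
  have [s sS xs] := SJ_split x; rewrite -(subrK s x); move: (x - s) xs => j jJ.
  rewrite !(mulvDl galgV) !(mulvDr galgV).
  have [? ?] := J_mul u jJ; have [? ?] := J_mul j vJ.
  have [? ?] := J_mul s vJ; have [? ?] := Kid s u sS uK.
  split; first by rewrite addrCA memv_add // !memvD.
  by rewrite [_ + mul u s]addrC -addrA memv_add // !memvD.
exists n.*2.+1 => x xKJ; rewrite (nprod_double galgV); apply: nJ => i.
have /memv_addP[u uK [v vJ ->]] := xKJ i.*2.
have /memv_addP[u' uK' [v' vJ' ->]] := xKJ i.*2.+1.
rewrite !(mulvDl galgV) !(mulvDr galgV) K2 // add0r.
by rewrite !memvD //; [apply: (J_mul _ _).1 | apply: (J_mul _ _).2 | apply: (J_mul _ _).1].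
Qed.

(* Brauer: a minimal left ideal L inside I either squares to zero, and then so does
   the ideal L + L S, or L a = L for some a in L and e a = a forces e to be idempotent. *)
Lemma ideal_idempotent I : ideal_in mul S I -> I != 0%VS ->
  exists e, [/\ e \in I, e != 0 & mul e e = e].
Proof.
move=> [IS Iid] I0.
pose P L := [/\ (L <= I)%VS, L != 0%VS & forall x y, x \in S -> y \in L -> mul x y \in L].
have [|L [LI L0 Lid] Lmin] := @minimal_vspace _ _ P I.
  by split=> // x y xS yI; case: (Iid x y xS yI).
have LS x : x \in L -> x \in S by move/(subvP LI)/(subvP IS).
have [L2|/not_all_ex_not[a]] := classic (forall a x, a \in L -> x \in L -> mul x a = 0).
  have K0 : (L + prodV mul L S)%VS = 0%VS.
    have mK x : x \in prodV mul L S -> (forall y, y \in S -> mul y x \in prodV mul L S)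
        /\ x \in S.
      move: x; apply: prodV_ind => [|a x y [Hx xS] [Hy yS]|a b aL bS].
      - by split=> [y _|]; rewrite ?(mulv0 galgV) mem0v.
      - by split=> [z zS|]; rewrite ?(mulPr galgV) memvD ?memvZ ?Hx ?Hy.
      split=> [y yS|]; last exact: S_mul (LS _ aL) bS.
      by rewrite mulA (mem_prodV galgV) // Lid.
    apply: square_zero_ideal.
      split.
        by rewrite subv_add (subv_trans LI IS); apply/subvP => x /mK[].
      move=> x y xS /memv_addP[u uL [v vP ->]]; split.
        by rewrite (mulvDr galgV) memv_add ?Lid //; apply: (mK _ vP).1.
      apply: (subvP (addvSr _ _)); rewrite (mulvDl galgV) memvD //.
        exact: (mem_prodV galgV).
      move: v vP; apply: prodV_ind => [|a z w Hz Hw|a b aL bS].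
      - by rewrite (mul0v galgV) mem0v.
      - by rewrite (mulPl galgV) memvD ?memvZ.
      by rewrite -mulA (mem_prodV galgV) // S_mul.
    have z1 x y : x \in L -> y \in (L + prodV mul L S)%VS -> mul x y = 0.
      move=> xL /memv_addP[u uL [v vP ->]]; rewrite (mulvDr galgV) L2 // add0r.
      move: v vP; apply: prodV_ind => [|a z w Hz Hw|a b aL bS].
      - exact: mulv0 galgV _.
      - by rewrite (mulPr galgV) Hz Hw scaler0 addr0.
      by rewrite mulA (L2 a x) // (mul0v galgV).
    have yS y : y \in (L + prodV mul L S)%VS -> y \in S.
      by move=> /memv_addP[u uL [v vP ->]]; rewrite memvD //; [exact: LS | exact: (mK _ vP).2].
    move=> x y /memv_addP[u uL [v vP ->]] yK; rewrite (mulvDl galgV) z1 // add0r.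
    move: v vP; apply: prodV_ind => [|a z w Hz Hw|a b aL bS].
    - exact: mul0v galgV _.
    - by rewrite (mulPl galgV) Hz Hw scaler0 addr0.
    rewrite -mulA; move: yK => /memv_addP[w wL [v vP ->]].
    by rewrite z1 // (mulvDr galgV) memv_add ?Lid //; apply: (mK _ vP).1.
  by case/negP: L0; rewrite -subv0 -K0 addvSl.
move=> /not_all_ex_not[b] H; have [aL H'] := imply_to_and _ _ H.
have [bL /eqP ba0] := imply_to_and _ _ H'.
have [phi phiE] : exists phi : 'End(V), forall x, phi x = mul x a.
  by apply: linear_lfun => c x y; rewrite (mulPl galgV).
have La : (phi @: L)%VS = L.
  have sub : (phi @: L <= L)%VS.
    by apply/subvP=> _ /memv_imgP[x xL ->]; rewrite phiE Lid ?LS.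
  apply: Lmin => //; split; first exact: subv_trans sub LI.
    apply: contra ba0 => /eqP E; rewrite -memv0 -E -phiE.
    exact: memv_img.
  move=> x _ xS /memv_imgP[y yL ->].
  by rewrite phiE mulA -phiE memv_img // Lid.
have /memv_imgP[e eL aE] : a \in (phi @: L)%VS by rewrite La.
have ea : mul e a = a by rewrite -phiE.
have a0 : a != 0 by apply: contra ba0 => /eqP ->; rewrite (mulv0 galgV).
have ker x : x \in L -> mul x a = 0 -> x = 0.
  move=> xL xa; apply/eqP; apply/idPn => x0.
  have E : (lker phi :&: L)%VS = L.
    apply: Lmin; last exact: capvSr.
    split; first by apply: subv_trans LI; apply: capvSr.
      apply: contra x0 => /eqP E0.
      by rewrite -memv0 -E0 memv_cap memv_ker phiE xa eqxx xL.
    move=> z y zS; rewrite !memv_cap !memv_ker !phiE => /andP[/eqP y0 yL].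
    by rewrite -mulA y0 (mulv0 galgV) eqxx Lid.
  have : e \in (lker phi :&: L)%VS by rewrite E.
  by rewrite memv_cap memv_ker phiE ea (negPf a0).
exists e; split; first exact: (subvP LI).
  by apply: contra a0 => /eqP e0; rewrite -ea e0 (mul0v galgV).
apply/eqP; rewrite -subr_eq0; apply/eqP/ker; first by rewrite memvB ?Lid ?LS.
by rewrite (mulvDl galgV) (mulvNl galgV) -mulA !ea subrr.
Qed.

Lemma J_iter x : x \in J -> exists n, forall y, iter n (mul x) y = 0.
Proof.
case: WM => [[_ [n nJ] _] _ _ _ _] xJ; exists n.+1 => y.
suff <- : mul (nprod mul (fun=> x) n) y = iter n.+1 (mul x) y.
  by rewrite nJ // (mul0v galgV).
elim: n {nJ} y => //= n IH y.
by rewrite -mulA IH -[RHS]/(iter n.+2 (mul x) y) iterSr.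
Qed.

Lemma fullv_graded : graded_sub gr fullv.
Proof. by rewrite /graded_sub -{1}(gr_full galgV); apply: eq_bigr => g _; rewrite capfv. Qed.

Section TraceForm.
Variables (M : {vspace V}) (d : nat) (g : 'I_d -> gT) (e : 'I_d -> V).
Hypotheses (hb : hbasis gr M g e) (SM : (S <= M)%VS) (Mmul : mul_closed mul M).
Local Notation t := (tr mul e).

Let stabM x : x \in M -> stab mul M x.
Proof. by move=> xM y yM; apply: Mmul. Qed.

(** The [x] in [S] with [t (mul x y) = 0] for all [y] in [M] form an ideal of [S]; an idempotent [f]
    in it would have [t f = 0], against [tr_idem] in characteristic 0. The space [M] is free because
    both [M = S] and [M = A] are used. *)
Lemma trace_form_nondeg x : x \in S -> (forall y, y \in M -> t (mul x y) = 0) -> x = 0.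
Proof.
have [phi phiE] : exists phi : 'Hom(V, 'rV[F]_d), forall x, phi x = \row_k t (mul x (e k)).
  apply: linear_lfun => a y z; apply/rowP=> k.
  by rewrite !mxE (mulPl galgV) (trP galgV).
have phiP y : reflect (forall z, z \in M -> t (mul y z) = 0) (y \in lker phi).
  rewrite memv_ker phiE; apply: (iffP eqP) => [/rowP E z zM|E].
    rewrite (hb_expand hb zM) (mulv_sumr galgV) (tr_sum galgV) big1 // => k _.
    rewrite (mulvZr galgV) (trZ galgV); have := E k; rewrite !mxE => ->.
    by rewrite mulr0.
  by apply/rowP=> k; rewrite !mxE E ?(hb_mem hb).
have SinM y : y \in S -> y \in M by move/(subvP SM).
have Iid : ideal_in mul S (S :&: lker phi)%VS.
  split=> [|y z yS /memv_capP[zS /phiP zK]]; first exact: capvSl.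
  split; rewrite memv_cap S_mul //; apply/phiP=> w wM.
    have zwM : mul z w \in M by apply: Mmul => //; apply: SinM.
    rewrite -mulA (tr_mulC galgV hb); [|exact/stabM/SinM|exact: stabM].
    by rewrite -mulA zK // Mmul // SinM.
  by rewrite -mulA zK // Mmul // SinM.
move=> xS xK; apply/eqP; apply/idPn => x0.
have [|f [/memv_capP[fS /phiP fK] f0 ff]] := ideal_idempotent Iid.
  apply: contra x0 => /eqP E; rewrite -memv0 -E memv_cap xS; exact/phiP.
have [||||r r0 rE] := tr_idem (x := f) (y := f) galgV hb; rewrite ?ff ?SinM //.
  exact/stabM/SinM.
have := fK f (SinM _ fS); rewrite ff rE => /eqP.
by rewrite (negPf (natf_neq0 r0)).
Qed.

End TraceForm.

(** [J] is the radical of the trace form of [A] acting on itself. That form pairs degree [h] only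
    with degree [h^-1], so its radical contains the homogeneous components of its elements. *)
Lemma J_graded : graded_sub gr J.
Proof.
have [d [g [e hb]]] := hbasis_exists galgV fullv_graded.
have fullm : mul_closed mul fullv by move=> *; apply: memvf.
have JP x : (x \in J) <-> forall y, tr mul e (mul x y) = 0.
  have J0 y z : y \in J -> tr mul e (mul y z) = 0.
    move=> yJ; have [n nil] := J_iter (J_mul z yJ).2.
    by apply: (tr_nilp galgV hb (n := n)) => // w _; apply: memvf.
  split=> [xJ y|H]; first exact: J0.
  have [s sS xs] := SJ_split x; rewrite -(subrK s x) memvD //.
  rewrite (trace_form_nondeg hb (subvf _) fullm sS) ?mem0v // => y _.
  have := H y; rewrite -{1}(subrK s x) (mulvDl galgV) (trD galgV) J0 //.
  by rewrite add0r.
apply: graded_subI => x xJ.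
have [c cM xc] := graded_subP fullv_graded (memvf x).
exists c => // h; have /memv_capP[_ ch] := cM h.
rewrite memv_cap ch andbT; apply/JP => y.
have [c' cM' ->] := graded_subP fullv_graded (memvf y).
rewrite (mulv_sumr galgV) (tr_sum galgV) big1 // => h' _.
have /memv_capP[_ ch'] := cM' h'.
have tdeg u v k l : u \in gr k -> v \in gr l -> (k * l)%g != 1%g -> tr mul e (mul u v) = 0.
  by move=> uk vl kl; apply: (tr_deg galgV hb _ (mul_gr galgV uk vl) kl) => w _; apply: memvf.
have [hh'|hh'] := eqVneq (h * h')%g 1%g; last exact: tdeg ch ch' hh'.
have /JP/(_ (c' h')) := xJ; rewrite xc (mulv_suml galgV) (tr_sum galgV) (bigD1 h) //=.
rewrite big1 ?addr0 // => k kh; have /memv_capP[_ ck] := cM k.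
by apply: tdeg ck ch' _; apply: contra kh => /eqP; rewrite -hh' => /mulIg ->.
Qed.

Lemma SJ_split_gr h v : v \in gr h ->
  exists s, [/\ s \in S, s \in gr h & v - s \in J].
Proof.
move=> vh; have [s sS vs] := SJ_split v.
have [c cS sE] := graded_subP S_graded sS.
have [c' cJ jE] := graded_subP J_graded vs.
have cP k : c k \in S /\ c k \in gr k by have /memv_capP[] := cS k.
have cP' k : c' k \in J /\ c' k \in gr k by have /memv_capP[] := cJ k.
exists (c h); case: (cP h) => cS' ch; split=> //.
have -> : v = c h + c' h.
  apply: (graded_subP_gr galgV (c := fun k => c k + c' k)) => //.
    by move=> k; rewrite memvD ?(cP _).2 ?(cP' _).2.
  by rewrite big_split /= -sE -jE addrC subrK.
by rewrite addrAC subrr add0r (cP' h).1.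
Qed.

(** * Dual bases, units and Casimir operators for a homogeneous basis adapted to the simple
    components *)

Section AdaptedBasis.
Variables (d : nat) (g : 'I_d -> gT) (e : 'I_d -> V) (ix : 'I_d -> 'I_q).
Hypotheses (hb : hbasis gr S g e) (eix : forall k, e k \in Ai (ix k)).
Local Notation t := (tr mul e).

Let stabS x : x \in S -> stab mul S x.
Proof. by move=> xS y yS; apply: S_mul. Qed.

Let eS k : e k \in S := hb_mem hb k.
Let eg k : e k \in gr (g k) := hb_gr hb k.

Lemma tS_nondeg x : x \in S -> (forall k, t (mul x (e k)) = 0) -> x = 0.
Proof.
move=> xS xe; apply: (trace_form_nondeg hb (subvv _) S_mul xS) => y yS.
rewrite (hb_expand hb yS) (mulv_sumr galgV) (tr_sum galgV) big1 // => k _.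
by rewrite (mulvZr galgV) (trZ galgV) xe mulr0.
Qed.

Lemma tS_mulC x y : x \in S -> y \in S -> t (mul x y) = t (mul y x).
Proof. by move=> xS yS; apply: (tr_mulC galgV hb); apply: stabS. Qed.

Lemma tS_deg x h : x \in S -> x \in gr h -> h != 1%g -> t x = 0.
Proof. by move=> xS; apply: (tr_deg galgV hb); apply: stabS. Qed.

Lemma gram_unit : \matrix_(k, l) t (mul (e k) (e l)) \in unitmx.
Proof.
rewrite -row_free_unit -kermx_eq0; apply/rowV0P=> v /sub_kermxP vG.
have E : \sum_k v 0 k *: e k = 0.
  apply: tS_nondeg => [|l]; first by apply: memv_suml => k _; rewrite memvZ ?eS.
  have /rowP/(_ l) := vG; rewrite !mxE => <-.
  rewrite (mulv_suml galgV) (tr_sum galgV); apply: eq_bigr => k _.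
  by rewrite (mulvZl galgV) (trZ galgV) mxE.
by apply/rowP=> k; rewrite mxE -(hb_cf hb (fun k => v 0 k)) E /cf linear0.
Qed.

Lemma dual_basis_raw : exists b : 'I_d -> V,
  (forall k, b k \in S) /\ forall m k, t (mul (e m) (b k)) = (m == k)%:R.
Proof.
pose Gm := \matrix_(k, l) t (mul (e k) (e l)).
exists (fun k => \sum_l invmx Gm l k *: e l); split=> [k|m k].
  by apply: memv_suml => l _; rewrite memvZ ?eS.
have /matrixP/(_ m k) := mulmxV gram_unit; rewrite !mxE => <-.
rewrite (mulv_sumr galgV) (tr_sum galgV); apply: eq_bigr => l _.
by rewrite (mulvZr galgV) (trZ galgV) mxE mulrC.
Qed.

(** Each vector of an arbitrary dual basis is truncated to the basis vectors of the component of
    [e k] and of degree inverse to that of [e k]; the discarded terms pair to 0 with every [e m] of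
    the same component and degree as [e k]. *)
Lemma dual_basis : exists b : 'I_d -> V,
  [/\ forall k, b k \in Ai (ix k), forall k, b k \in gr (g k)^-1%g &
      forall m k, t (mul (e m) (b k)) = (m == k)%:R].
Proof.
have [b' [bS bE]] := dual_basis_raw.
pose Q k l := (ix l == ix k) && (g l == (g k)^-1)%g.
exists (fun k => \sum_(l | Q k l) cf e l (b' k) *: e l).
have bA k : \sum_(l | Q k l) cf e l (b' k) *: e l \in Ai (ix k).
  by apply: memv_suml => l /andP[/eqP <- _]; rewrite memvZ ?eix.
have bg k : \sum_(l | Q k l) cf e l (b' k) *: e l \in gr (g k)^-1%g.
  by apply: memv_suml => l /andP[_ /eqP <-]; rewrite memvZ ?eg.
split=> // m k.
have [ixmk|ixmk] := eqVneq (ix m) (ix k); last first.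
  rewrite (Ai_orth ixmk (eix m) (bA k)) (tr0 galgV).
  by case: (m =P k) ixmk => [->|//]; rewrite eqxx.
have [gmk|gmk] := eqVneq (g m) (g k); last first.
  rewrite (tS_deg _ (mul_gr galgV (eg m) (bg k))).
  - by case: (m =P k) gmk => [->|//]; rewrite eqxx.
  - by apply: S_mul => //; apply: (subvP (Ai_sub (ix k))).
  by apply: contra gmk => /eqP/(canRL (mulgKV _)); rewrite mul1g => ->.
rewrite -bE {2}(hb_expand hb (bS k)) !(mulv_sumr galgV) !(tr_sum galgV).
rewrite [RHS](bigID (Q k)) /= [X in _ = _ + X]big1 ?addr0 // => l.
rewrite negb_and (mulvZr galgV) (trZ galgV) => /orP[nl|nl].
  by rewrite (Ai_orth _ (eix m) (eix l)) ?(tr0 galgV) ?mulr0 // ixmk eq_sym.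
rewrite  (tS_deg _ (mul_gr galgV (eg m) (eg l))) ?mulr0 ?S_mul //.
apply: contra nl => /eqP/(canRL (mulKg _)); rewrite mulg1 gmk => ->.
by rewrite eqxx.
Qed.

(** The unit is the element representing the functional [t]: from [t (mul u x) = t x] for all [x] in
    [S], nondegeneracy gives [u x = x] and [x u = x]. *)
Lemma S_unit : exists2 u, u \in S & forall x, x \in S -> mul u x = x /\ mul x u = x.
Proof.
have [b [bS bE]] := dual_basis_raw.
pose u := \sum_k t (e k) *: b k.
have uS : u \in S by apply: memv_suml => k _; rewrite memvZ.
have ut x : x \in S -> t (mul u x) = t x.
  move=> xS; rewrite tS_mulC // (hb_expand hb xS) (mulv_suml galgV).
  rewrite !(tr_sum galgV); apply: eq_bigr => k _.
  rewrite (mulvZl galgV) (trZ galgV) (trZ galgV) /u (mulv_sumr galgV) (tr_sum galgV).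
  congr (_ * _); rewrite (bigD1 k) //= big1 ?addr0.
    by rewrite (mulvZr galgV) (trZ galgV) bE eqxx mulr1.
  by move=> l lk; rewrite (mulvZr galgV) (trZ galgV) bE eq_sym (negPf lk) mulr0.
exists u => // x xS; split; apply/eqP; rewrite -subr_eq0; apply/eqP/tS_nondeg.
- by rewrite memvB ?S_mul.
- move=> k; rewrite (mulvDl galgV) (mulvNl galgV) (trD galgV) -scaleN1r.
  by rewrite (trZ galgV) -mulA ut ?S_mul // mulN1r subrr.
- by rewrite memvB ?S_mul.
move=> k; rewrite (mulvDl galgV) (mulvNl galgV) (trD galgV) -scaleN1r.
rewrite (trZ galgV) -mulA [t (mul x (mul u _))]tS_mulC ?S_mul // -mulA ut ?S_mul //.
by rewrite mulN1r tS_mulC // subrr.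
Qed.

(** The [un i] are the components of the unit of [S]. Comparing degrees in [un i * x = x] for
    homogeneous [x] shows that the part of [un i] of degree 1 is already a left unit, hence equals
    [un i]. *)
Lemma Ai_unit : exists un : 'I_q -> V,
  forall i, [/\ un i \in Ai i, un i \in gr 1%g &
    forall x, x \in Ai i -> mul (un i) x = x /\ mul x (un i) = x].
Proof.
have [u uS uE] := S_unit.
have /memv_sumP[un unA uun] := uS.
exists un => i; have ui := unA i isT.
have uiE x : x \in Ai i -> mul (un i) x = x /\ mul x (un i) = x.
  move=> xA; have [ux xu] := uE x (subvP (Ai_sub i) _ xA).
  split.
    rewrite -{2}ux uun (mulv_suml galgV) (bigD1 i) //= big1 ?addr0 // => j ji.
    exact: Ai_orth ji (unA j isT) xA.
  rewrite -{2}xu uun (mulv_sumr galgV) (bigD1 i) //= big1 ?addr0 // => j ji.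
  by apply: (Ai_orth _ xA (unA j isT)); rewrite eq_sym.
split=> //.
have [c cA uc] := graded_subP (Ai_graded i) ui.
have cP h : c h \in Ai i /\ c h \in gr h by have /memv_capP[] := cA h.
have homl x h : x \in Ai i -> x \in gr h -> mul (c 1%g) x = x.
  move=> xA xh; have [ux _] := uiE x xA.
  pose c' k := mul (c (k * h^-1)%g) x.
  have -> : mul (c 1%g) x = c' h by rewrite /c' mulgV.
  apply/esym; apply: (graded_subP_gr galgV (c := c')) => // [k|].
    by have := mul_gr galgV (cP (k * h^-1)%g).2 xh; rewrite mulgKV.
  rewrite -{1}ux uc (mulv_suml galgV) /c'.
  rewrite [RHS](reindex_inj (mulIg h)) /=.
  by apply: eq_bigr => k _; rewrite mulgK.
have -> : un i = c 1%g; last exact: (cP _).2.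
rewrite -[RHS](uiE _ (cP 1%g).1).2.
have [c' cA' u'] := graded_subP (Ai_graded i) ui.
rewrite {2}u' (mulv_sumr galgV) {1}u'; apply: eq_bigr => h _.
by have /memv_capP[? ?] := cA' h; rewrite (homl _ h).
Qed.

Variables (un : 'I_q -> V) (b : 'I_d -> V).
Hypothesis unP : forall i, [/\ un i \in Ai i, un i \in gr 1%g &
    forall x, x \in Ai i -> mul (un i) x = x /\ mul x (un i) = x].
Hypotheses (bA : forall k, b k \in Ai (ix k)) (bg : forall k, b k \in gr (g k)^-1%g)
  (tb : forall m k, t (mul (e m) (b k)) = (m == k)%:R).

Let bS k : b k \in S := subvP (Ai_sub (ix k)) _ (bA k).

Lemma cf_dual k x : x \in S -> cf e k x = t (mul x (b k)).
Proof.
move=> xS; rewrite {2}(hb_expand hb xS) (mulv_suml galgV) (tr_sum galgV).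
rewrite (bigD1 k) //= big1 ?addr0; first by rewrite (mulvZl galgV) (trZ galgV) tb eqxx mulr1.
by move=> l /negPf lk; rewrite (mulvZl galgV) (trZ galgV) tb lk mulr0.
Qed.

Lemma dual_expand x : x \in S -> x = \sum_k t (mul x (e k)) *: b k.
Proof.
move=> xS; apply/eqP; rewrite -subr_eq0; apply/eqP/tS_nondeg => [|m].
  by rewrite memvB // memv_suml // => k _; rewrite memvZ.
rewrite (mulvDl galgV) (mulvNl galgV) (trD galgV) -scaleN1r (trZ galgV) mulN1r.
rewrite (mulv_suml galgV) (tr_sum galgV) (bigD1 m) //= big1 ?addr0.
  by rewrite (mulvZl galgV) (trZ galgV) (tS_mulC (bS m)) // tb eqxx mulr1 subrr.
move=> l /negPf lm.
by rewrite (mulvZl galgV) (trZ galgV) (tS_mulC (bS l)) // tb eq_sym lm mulr0.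
Qed.

Definition casimir x := \sum_l mul (mul (e l) x) (b l).

(** Expanding [w e_l] in the basis [e] and [b_m w] in the dual basis [b] produces the same
    coefficients [t (w e_l b_m)]. *)
Lemma casimir_central x w : x \in S -> w \in S ->
  mul w (casimir x) = mul (casimir x) w.
Proof.
move=> xS wS; rewrite /casimir (mulv_sumr galgV) (mulv_suml galgV).
transitivity (\sum_l \sum_m t (mul (mul w (e l)) (b m)) *: mul (mul (e m) x) (b l)).
  apply: eq_bigr => l _; rewrite !mulA {1}(hb_expand hb (S_mul wS (eS l))).
  rewrite !(mulv_suml galgV); apply: eq_bigr => m _.
  by rewrite !(mulvZl galgV) cf_dual ?S_mul.
rewrite exchange_big /=; apply: eq_bigr => m _.
rewrite -mulA [X in _ = mul _ X](dual_expand (S_mul (bS m) wS)) (mulv_sumr galgV).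
apply: eq_bigr => l _; rewrite (mulvZr galgV); congr (_ *: _).
by rewrite tS_mulC ?S_mul // mulA.
Qed.

(** By symmetry of [t], the sums of [b_l e_l] and of [e_l b_l] agree; and [t (x e_l b_l)] is the
    coordinate of [x e_l] at [e_l], a diagonal entry of left multiplication by [x]. *)
Lemma tr_casimir x : x \in S -> t (casimir x) = t x.
Proof.
move=> xS.
have swap : \sum_l mul (b l) (e l) = \sum_l mul (e l) (b l).
  transitivity (\sum_l \sum_m t (mul (e l) (e m)) *: mul (b l) (b m)).
    apply: eq_bigr => l _; rewrite {1}(dual_expand (eS l)) (mulv_sumr galgV).
    by apply: eq_bigr => m _; rewrite (mulvZr galgV).
  rewrite exchange_big /=; apply: eq_bigr => m _.
  rewrite [in RHS](dual_expand (eS m)) (mulv_suml galgV).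
  by apply: eq_bigr => l _; rewrite (mulvZl galgV) tS_mulC.
transitivity (t (mul x (\sum_l mul (b l) (e l)))).
  rewrite (mulv_sumr galgV) !(tr_sum galgV); apply: eq_bigr => l _.
  by rewrite -mulA tS_mulC ?S_mul // mulA.
rewrite swap (mulv_sumr galgV) (tr_sum galgV) {2}/tr; apply: eq_bigr => l _.
by rewrite cf_dual ?S_mul // mulA.
Qed.

(** A graded Schur lemma: [z] has an eigenvalue because [F] is algebraically closed, and the
    eigenspace is a nonzero ideal of [Ai i], graded because [z] has degree 1. Simplicity makes it
    everything, and it is applied to the unit. *)
Lemma Ai_center i z : z \in Ai i -> z \in gr 1%g ->
  (forall x, x \in Ai i -> mul z x = mul x z) -> exists c, z = c *: un i.
Proof.
move=> zA z1 zC; have [uA u1 uE] := unP i.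
have [d' [g' [e' hb']]] := hbasis_exists galgV (Ai_graded i).
have sz : stab mul (Ai i) z by move=> y yA; apply: Ai_mul.
have [_ _ [x0 [y0 [x0A y0A xy0]]] simp] : graded_simple_sub mul gr (Ai i) by case: WM.
have d0 : (0 < d')%N.
  case: d' g' e' hb' => // g' e' hb'; case/negP: xy0.
  by rewrite (hb_expand hb' x0A) big_ord0 (mul0v galgV).
have [c] : exists c, root (char_poly (reg mul e' z)) c.
  by apply/closed_rootP; rewrite size_char_poly; case: d' d0 {g' e' hb'}.
rewrite -eigenvalue_root_char => /eigenvalueP[v vz v0].
exists c.
have [phi phiE] : exists phi : 'End(V), forall x, phi x = mul z x - c *: x.
  apply: linear_lfun => a x y; rewrite (mulPr galgV) scalerBr scalerDr !scalerA.
  by rewrite opprD addrACA [c * a]mulrC.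
have phiP x : (x \in (Ai i :&: lker phi)%VS) = (x \in Ai i) && (mul z x == c *: x).
  by rewrite memv_cap memv_ker phiE subr_eq0.
have [||I0|IA] := simp (Ai i :&: lker phi)%VS.
- split=> [|x y xA]; first exact: capvSl.
  rewrite phiP => /andP[yA /eqP zy]; split; rewrite phiP Ai_mul //=.
    by rewrite mulA zC // -mulA zy (mulvZr galgV).
  by rewrite mulA zy (mulvZl galgV).
- apply: graded_subI => x; rewrite phiP => /andP[xA /eqP zx].
  have [a aA xE] := graded_subP (Ai_graded i) xA.
  have aP h : a h \in Ai i /\ a h \in gr h by have /memv_capP[] := aA h.
  exists a => // h; rewrite memv_cap phiP (aP h).1 (aP h).2 /= andbT.
  have ch : c *: a h \in gr h by rewrite memvZ ?(aP h).2.
  have E : \sum_k (mul z (a k) - c *: a k) = 0.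
    by rewrite sumrB -(mulv_sumr galgV) -scaler_sumr -xE zx subrr.
  rewrite -subr_eq0; apply/eqP.
  move/directv_sum_independent: (gr_direct galgV) => /(_ (fun k => mul z (a k) - c *: a k)).
  apply=> // k _; rewrite memvB ?memvZ ?(aP k).2 //.
  by have := mul_gr galgV z1 (aP k).2; rewrite mul1g.
- pose x := \sum_k v 0 k *: e' k.
  have : x \in (Ai i :&: lker phi)%VS.
    rewrite phiP memv_suml => [|k _]; last by rewrite memvZ ?(hb_mem hb').
    apply/eqP; rewrite (mulv_sumr galgV) scaler_sumr.
    under eq_bigr => k _ do rewrite (mulvZr galgV) (reg_expand hb' _ sz) scaler_sumr.
    rewrite exchange_big /=; apply: eq_bigr => l _.
    have /rowP/(_ l) := vz; rewrite !mxE scalerA => <-; rewrite scaler_suml.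
    by apply: eq_bigr => k _; rewrite scalerA.
  rewrite I0 memv0 => /eqP x0'; case/negP: v0; apply/eqP/rowP=> k.
  by rewrite mxE -(hb_cf hb' (fun k => v 0 k)) -/x x0' /cf linear0.
move: uA; rewrite -IA phiP => /andP[uA /eqP <-].
by rewrite (uE z zA).2.
Qed.

(** The Casimir element is a scalar multiple of [un i] by [Ai_center], and [tr_casimir] determines
    the scalar. The cross-multiplied form avoids a division. *)
Lemma casimir_scalar i x : x \in Ai i -> x \in gr 1%g ->
  t (un i) *: casimir x = t x *: un i.
Proof.
move=> xA x1; have xS := subvP (Ai_sub i) _ xA.
have [|||c cE] := @Ai_center i (casimir x).
- by apply: memv_suml => l _; rewrite Ai_mulSr // Ai_mulSl.
- apply: memv_suml => l _.
  by have := mul_gr galgV (mul_gr galgV (eg l) x1) (bg l); rewrite mulg1 mulgV.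
- by move=> w wA; rewrite casimir_central // (subvP (Ai_sub i)).
rewrite -(tr_casimir xS) cE (trZ galgV) scalerA.
by congr (_ *: _); rewrite mulrC.
Qed.

(** The case [x = z b_k] of [casimir_scalar]. By [cf_dual] the factor [t (mul z (b k))] is the
    coordinate of [z] at [e k], so a polynomial in [z] reads off this coordinate. *)
Lemma coordinate_extraction k z : z \in S -> z \in gr (g k) ->
  \sum_l mul (mul (e l) z) (t (un (ix k)) *: mul (b k) (b l))
    = t (mul z (b k)) *: un (ix k).
Proof.
move=> zS zg; rewrite -casimir_scalar.
- rewrite /casimir scaler_sumr; apply: eq_bigr => l _.
  by rewrite (mulvZr galgV) !mulA.
- by rewrite Ai_mulSl.
by have := mul_gr galgV zg (bg k); rewrite mulgV.
Qed.

End AdaptedBasis.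

End WedderburnMalcev.

(** * Noncommutative polynomials and powers of the radical *)

Section Embedding.
Import VectorInternalTheory.
Variables (F : fieldType) (gT : finGroupType) (V : vectType F).
Variables (mul : V -> V -> V) (gr : gT -> {vspace V}).
Hypothesis galgV : galg mul gr.

Definition rmulmx (x : V) : 'M[F]_(dim V) :=
  \matrix_i v2r (mul (r2v (delta_mx 0 i)) x).

(* The right regular representation of V on F + V, which is faithful although V
   need not have a unit. *)
Definition emb (x : V) : 'M[F]_((dim V).+1) :=
  block_mx (0 : 'M_1) (v2r x) 0 (rmulmx x).

Lemma v2r_rmulmx x y : v2r y *m rmulmx x = v2r (mul y x).
Proof.
rewrite mulmx_sum_row -{2}(v2rK y) [v2r y in RHS]row_sum_delta linear_sum.
rewrite (mulv_suml galgV) linear_sum; apply: eq_bigr => i _.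
by rewrite rowK linearZ /= (mulvZl galgV) linearZ.
Qed.

Lemma rmulmxM x y : rmulmx (mul x y) = rmulmx x *m rmulmx y.
Proof.
by apply/row_matrixP=> i; rewrite row_mul !rowK v2r_rmulmx (mulvA galgV).
Qed.

Lemma embP a x y : emb (a *: x + y) = a *: emb x + emb y.
Proof.
pose B u : 'M[F]_(1 + dim V) := block_mx (0 : 'M_1) (v2r u) 0 (rmulmx u).
suff : B (a *: x + y) = a *: B x + B y by [].
rewrite /B scale_block_mx add_block_mx !scaler0 !addr0 linearP.
congr (block_mx _ _ _ _); apply/row_matrixP=> i.
by rewrite linearP /= !rowK (mulPr galgV) linearP.
Qed.

Lemma embM x y : emb (mul x y) = emb x * emb y.
Proof.
pose B u : 'M[F]_(1 + dim V) := block_mx (0 : 'M_1) (v2r u) 0 (rmulmx u).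
suff : B (mul x y) = B x *m B y by [].
rewrite /B mulmx_block !mul0mx !mulmx0 !add0r.
by rewrite v2r_rmulmx rmulmxM.
Qed.

Lemma emb0 : emb 0 = 0.
Proof.
have := embP 1 0 0; rewrite !scale1r addr0 -{1}[emb 0]addr0.
by move/addrI => <-.
Qed.

Lemma embD x y : emb (x + y) = emb x + emb y.
Proof. by have := embP 1 x y; rewrite !scale1r. Qed.

Lemma embZ a x : emb (a *: x) = a *: emb x.
Proof. by have := embP a x 0; rewrite emb0 !addr0. Qed.

Lemma emb_sum (I : Type) (r : seq I) (P : pred I) f :
  emb (\sum_(i <- r | P i) f i) = \sum_(i <- r | P i) emb (f i).
Proof. by apply: big_morph => [x y|]; rewrite ?embD ?emb0. Qed.

Lemma emb_inj x : emb x = 0 -> x = 0.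
Proof.
move=> E; have {}E : block_mx (0 : 'M_1) (v2r x) 0 (rmulmx x) = 0 by exact: E.
apply: v2r_inj; rewrite linear0 -[LHS](block_mxKur (0 : 'M_1) (v2r x) 0 (rmulmx x)) E.
by apply/matrixP=> i j; rewrite !mxE.
Qed.

(** The corner entry separates the constant term of a unital expression from its part in [V]. *)
Lemma emb00 x : emb x ord0 ord0 = 0.
Proof.
have := block_mxEul (0 : 'M_1) (v2r x) 0 (rmulmx x) ord0 ord0.
rewrite [RHS]mxE => <-; rewrite -/(emb x).
by rewrite (_ : ord0 = lshift (dim V) (ord0 : 'I_1)) //; apply: val_inj.
Qed.

End Embedding.

(** * Expressions uniform in the algebra, and the graded polynomials behind them *)

Section Expressions.
Variables (F : fieldType) (gT : finGroupType).

Inductive expr (L : Type) : Type :=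
  | EOne | EVar of L | EAdd of expr L & expr L | EScale of F & expr L
  | EMul of expr L & expr L.
Arguments EOne {L}.

Fixpoint evalE (L : Type) (R : algType F) (x : L -> R) (e : expr L) : R :=
  match e with
  | EOne => 1
  | EVar l => x l
  | EAdd e1 e2 => evalE x e1 + evalE x e2
  | EScale a e1 => a *: evalE x e1
  | EMul e1 e2 => evalE x e1 * evalE x e2
  end.

(** One expression must serve all algebras [R] at once; this allows the same polynomial to be
    evaluated in the matrix algebras that contain [A] and [B]. *)
Definition definable (L : Type) (Phi : forall R : algType F, (L -> R) -> R) :=
  exists e : expr L, forall R x, Phi R x = evalE x e.

Section Closure.
Variable L : Type.
Implicit Types Phi Psi : forall R : algType F, (L -> R) -> R.

Lemma definable_var l : definable (fun R (x : L -> R) => x l).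
Proof. by exists (EVar l). Qed.

Lemma definable0 : definable (fun R (x : L -> R) => 0).
Proof. by exists (EScale 0 EOne) => R x /=; rewrite scale0r. Qed.

Lemma definableD Phi Psi : definable Phi -> definable Psi ->
  definable (fun R x => Phi R x + Psi R x).
Proof. by case=> e He [e' He']; exists (EAdd e e') => R x; rewrite He He'. Qed.

Lemma definableM Phi Psi : definable Phi -> definable Psi ->
  definable (fun R x => Phi R x * Psi R x).
Proof. by case=> e He [e' He']; exists (EMul e e') => R x; rewrite He He'. Qed.

Lemma definableZ a Phi : definable Phi -> definable (fun R x => a *: Phi R x).
Proof. by case=> e He; exists (EScale a e) => R x; rewrite He. Qed.

Lemma definable_sum (I : Type) (r : seq I) (P : pred I)
   (Phi : I -> forall R : algType F, (L -> R) -> R) :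
  (forall i, P i -> definable (Phi i)) ->
  definable (fun R x => \sum_(i <- r | P i) Phi i R x).
Proof.
move=> H; elim: r => [|i r [e IH]].
  by exists (EScale 0 EOne) => R x; rewrite big_nil /= scale0r.
case: (boolP (P i)) => Pi; last by exists e => R x; rewrite big_cons (negPf Pi).
by have [e' He'] := H i Pi; exists (EAdd e' e) => R x; rewrite big_cons Pi IH He'.
Qed.

Lemma definable_prod (I : Type) (r : seq I) (P : pred I)
   (Phi : I -> forall R : algType F, (L -> R) -> R) :
  (forall i, P i -> definable (Phi i)) ->
  definable (fun R x => \prod_(i <- r | P i) Phi i R x).
Proof.
move=> H; elim: r => [|i r [e IH]]; first by exists EOne => R x; rewrite big_nil.
case: (boolP (P i)) => Pi; last by exists e => R x; rewrite big_cons (negPf Pi).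
by have [e' He'] := H i Pi; exists (EMul e' e) => R x; rewrite big_cons Pi IH He'.
Qed.

End Closure.

Section Words.
Variables (V : vectType F) (mul : V -> V -> V) (gr : gT -> {vspace V}).
Hypothesis galgV : galg mul gr.

Definition wcat (v w : gword gT) : gword gT := (v.1, v.2 ++ w.1 :: w.2).

Lemma eval_wcat s v w :
  eval_word mul s (wcat v w) = mul (eval_word mul s v) (eval_word mul s w).
Proof.
rewrite /eval_word /wcat /= foldl_cat /=; move: (foldl _ _ v.2) => y.
elim/last_ind: w.2 => [|r u IH] //=.
by rewrite -!cats1 !foldl_cat /= IH (mulvA galgV).
Qed.

Lemma eval_gpoly_cat s (p p' : gpoly F gT) :
  eval_gpoly mul s (p ++ p') = eval_gpoly mul s p + eval_gpoly mul s p'.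
Proof. by rewrite /eval_gpoly big_cat. Qed.

Lemma eval_gpoly_scale s a (p : gpoly F gT) :
  eval_gpoly mul s [seq (a * m.1, m.2) | m <- p] = a *: eval_gpoly mul s p.
Proof.
rewrite /eval_gpoly big_map scaler_sumr; apply: eq_bigr => m _.
by rewrite scalerA.
Qed.

Lemma eval_gpoly_mul s (p p' : gpoly F gT) :
  eval_gpoly mul s [seq (m.1 * m'.1, wcat m.2 m'.2) | m <- p, m' <- p'] =
  mul (eval_gpoly mul s p) (eval_gpoly mul s p').
Proof.
rewrite /eval_gpoly big_allpairs_dep (mulv_suml galgV); apply: eq_bigr => m _.
rewrite (mulv_sumr galgV); apply: eq_bigr => m' _.
by rewrite eval_wcat (mulvZl galgV) (mulvZr galgV) scalerA.
Qed.

End Words.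

(** Expressions have a unit but [gpoly] has none, so the constant term [c] is kept apart. The label
    [l] becomes the graded variable with index [pickle l] and degree [deg l]. *)
Lemma expr_gpoly (L : countType) (deg : L -> gT) (e : expr L) :
  exists (c : F) (p : gpoly F gT), forall (V : vectType F) mul gr,
  @galg F gT V mul gr -> forall (sv : L -> V) (s : nat -> gT -> V),
  (forall l, s (pickle l) (deg l) = sv l) ->
  evalE (emb mul \o sv) e = c%:A + emb mul (eval_gpoly mul s p).
Proof.
elim: e => [|l|e1 [c1 [p1 H1]] e2 [c2 [p2 H2]]|a e1 [c1 [p1 H1]]|e1 [c1 [p1 H1]] e2 [c2 [p2 H2]]].
- exists 1, [::] => V mul gr galgV sv s E.
  by rewrite /eval_gpoly big_nil (emb0 galgV) addr0 scale1r.
- exists 0, [:: (1, ((pickle l, deg l), [::]))] => V mul gr galgV sv s E.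
  by rewrite /eval_gpoly big_seq1 scale0r add0r scale1r /= -E.
- exists (c1 + c2), (p1 ++ p2) => V mul gr galgV sv s E /=.
  rewrite (H1 _ _ _ galgV _ _ E) (H2 _ _ _ galgV _ _ E) eval_gpoly_cat (embD galgV).
  by rewrite scalerDl addrACA.
- exists (a * c1), [seq (a * m.1, m.2) | m <- p1] => V mul gr galgV sv s E /=.
  by rewrite (H1 _ _ _ galgV _ _ E) eval_gpoly_scale (embZ galgV) scalerDr scalerA.
exists (c1 * c2), ([seq (c1 * m.1, m.2) | m <- p2] ++ [seq (c2 * m.1, m.2) | m <- p1] ++
  [seq (m.1 * m'.1, wcat m.2 m'.2) | m <- p1, m' <- p2]) => V mul gr galgV sv s E /=.
rewrite (H1 _ _ _ galgV _ _ E) (H2 _ _ _ galgV _ _ E) !eval_gpoly_cat !eval_gpoly_scale.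
rewrite (eval_gpoly_mul galgV) !(embD galgV) !(embZ galgV) (embM galgV).
rewrite mulrDl !mulrDr -!scalerAl -!scalerAr !mul1r !mulr1 scalerA.
by rewrite -!addrA.
Qed.

Definition label_val (L : countType) (deg : L -> gT) (V : vectType F) (sv : L -> V) n (h : gT) :=
  if unpickle n is Some l then if deg l == h then sv l else 0 else 0 : V.

Lemma label_valE (L : countType) (deg : L -> gT) (V : vectType F) (sv : L -> V) l :
  label_val deg sv (pickle l) (deg l) = sv l.
Proof. by rewrite /label_val pickleK eqxx. Qed.

Lemma label_val_gr (L : countType) (deg : L -> gT) (V : vectType F) (sv : L -> V)
    (gr : gT -> {vspace V}) :
  (forall l, sv l \in gr (deg l)) -> forall n h, label_val deg sv n h \in gr h.
Proof.
move=> H n h; rewrite /label_val; case: unpickle => [l|]; last exact: mem0v.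
by case: eqP => [<-|_] //; apply: mem0v.
Qed.

Lemma algebra_const0 n (c : F) (M : 'M[F]_n.+1) : M ord0 ord0 = 0 -> c%:A + M = 0 -> c = 0.
Proof.
by move=> M0 /matrixP/(_ ord0 ord0); rewrite !mxE M0 mulr1 addr0.
Qed.

Lemma definable_transfer (V W : vectType F) mulV grV mulW grW
  (L : countType) (deg : L -> gT) (Phi : forall R : algType F, (L -> R) -> R) :
  @galg F gT V mulV grV -> @galg F gT W mulW grW ->
  (forall p : gpoly F gT, is_gid mulV grV p -> is_gid mulW grW p) ->
  definable Phi ->
  (forall sv, (forall l, sv l \in grV (deg l)) -> Phi _ (emb mulV \o sv) = 0) ->
  (forall sv, (forall l, sv l \in grW (deg l)) -> Phi _ (emb mulW \o sv) = 0).
Proof.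
move=> gV gW idVW [e He] HV sv svg.
have [c [p H]] := expr_gpoly deg e.
(* One admissible valuation, here the zero one, suffices: embedded elements have corner entry 0, so
   the corner entry of the value is [c]. *)
have c0 : c = 0.
  have := HV (fun=> 0) (fun l => mem0v _).
  rewrite He (H _ _ _ gV _ _ (label_valE deg (fun=> 0))).
  by apply: algebra_const0; apply: emb00.
have idp : is_gid mulV grV p.
  move=> s sg; apply: (@emb_inj F V mulV).
  have := HV (fun l => s (pickle l) (deg l)) (fun l => sg _ _).
  by rewrite He (H _ _ _ gV _ s) // c0 scale0r add0r.
rewrite He (H _ _ _ gW _ _ (label_valE deg sv)) c0 scale0r add0r.
by rewrite idVW ?(emb0 gW) //; apply: label_val_gr.
Qed.

(** * Counting factors from the radical in the values of a polynomial *)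

Section NilpotentCounting.
Variables (V : vectType F) (mul : V -> V -> V) (gr : gT -> {vspace V}).
Hypothesis galgV : galg mul gr.
Variable J : {vspace V}.
Hypothesis Jid : ideal_in mul fullv J.

(** The first power is set to [J] separately: in an algebra without unit the product of [A] and [J]
    may be smaller than [J]. *)
Fixpoint Jpow (r : nat) : {vspace V} :=
  match r with
  | 0 => fullv
  | r'.+1 => if r' is 0 then J else prodV mul (Jpow r') J
  end.

Lemma Jpow_mulr r x y : x \in Jpow r -> mul x y \in Jpow r.
Proof.
case: r => [|[|r]] /= xJ; first exact: memvf.
  by have [_ /(_ y x (memvf _) xJ)[]] := Jid.
move: x xJ; apply: prodV_ind => [|a u v Hu Hv|a j aJ jJ].
- by rewrite (mul0v galgV) mem0v.
- by rewrite (mulPl galgV) memvD ?memvZ.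
rewrite -(mulvA galgV) (mem_prodV galgV) //.
by have [_ /(_ y j (memvf _) jJ)[]] := Jid.
Qed.

Lemma Jpow_mul r s x y : x \in Jpow r -> y \in Jpow s -> mul x y \in Jpow (r + s).
Proof.
elim: s y => [|s IH] y xJ; first by rewrite addn0 => _; apply: Jpow_mulr.
rewrite addnS; case: s IH => [|s] IH /=.
  rewrite addn0; case: r xJ {IH} => [|r] xJ yJ; last by rewrite (mem_prodV galgV).
  by have [_ /(_ x y (memvf _) yJ)[]] := Jid.
rewrite addnS => yJ; move: y yJ; apply: prodV_ind => [|a u v Hu Hv|a j aJ jJ].
- by rewrite (mulv0 galgV) mem0v.
- by rewrite (mulPr galgV) memvD ?memvZ.
rewrite (mulvA galgV); have := IH a xJ aJ; rewrite addnS => H.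
exact: (mem_prodV galgV).
Qed.

Lemma Jpow_sub r s x : (r <= s)%N -> x \in Jpow s -> x \in Jpow r.
Proof.
elim: s => [|s IH]; first by rewrite leqn0 => /eqP ->.
rewrite leq_eqVlt => /predU1P[-> //|rs xJ]; apply: IH => //.
move: xJ; case: s {rs} => [|s] /=; first by rewrite memvf.
move: x; apply: prodV_ind => [|a u v Hu Hv|a j aJ jJ].
- exact: mem0v.
- by rewrite memvD ?memvZ.
exact: (@Jpow_mulr s.+1).
Qed.

Lemma Jpow_nilpotent n x : (forall x, (forall k, x k \in J) -> nprod mul x n = 0) ->
  x \in Jpow n.+1 -> x = 0.
Proof.
move=> nJ.
(* The statement is generalized to an element of the power [r + 1] followed by [n - r] factors from
   [J]: the factors of the power move one by one into the list [l], until [n + 1] elements of [J]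
   are multiplied. *)
suff H r : (r <= n)%N -> forall w, w \in Jpow r.+1 -> forall l, size l = (n - r)%N ->
    (forall y, y \in l -> y \in J) -> foldl mul w l = 0.
  by move=> xJ; apply: (H n (leqnn n) x xJ [::]); rewrite ?subnn.
elim: r => [_|r IH rn] w.
  rewrite subn0 /= => wJ l ln lJ.
  rewrite -(nJ (fun k => nth 0 (w :: l) k)); last first.
    move=> k; have [kl|kl] := ltnP k (size (w :: l)); last by rewrite nth_default ?mem0v.
    by have := mem_nth 0 kl; rewrite inE => /predU1P[-> //|/lJ].
  rewrite -ln; elim/last_ind: l {ln lJ} => //= l z IHl.
  rewrite foldl_rcons size_rcons /= IHl nth_rcons ltnn eqxx; congr (mul _ _).
  by apply: eq_nprod => -[|k] //= kl; rewrite nth_rcons kl.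
move=> wJ l ln lJ; move: w wJ; apply: prodV_ind => [|a u v Hu Hv|a j aJ jJ].
- by elim: l {ln lJ} => //= z l IHl; rewrite (mul0v galgV).
- have fD l' u' v' : foldl mul (a *: u' + v') l' = a *: foldl mul u' l' + foldl mul v' l'.
    by elim: l' u' v' => //= z l' IHl u' v'; rewrite (mulPl galgV).
  by rewrite fD Hu Hv scaler0 addr0.
apply: (IH (ltnW rn) a aJ (j :: l)) => [|y].
  by rewrite /= ln subnSK.
by rewrite inE => /predU1P[->|/lJ].
Qed.

Section Modes.
Variable N : nat.
Implicit Types phi : {set 'I_N} -> V.

(* phi(theta) is a sum over T of terms which carry a factor of J for every group in T
   and occur only when the groups in T are evaluated without projecting J away. *)
Definition Jmodes phi := exists psi : {set 'I_N} -> V,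
  (forall T, psi T \in Jpow #|T|) /\
  forall theta, phi theta = \sum_(T : {set 'I_N} | T \subset theta) psi T.

Lemma Jmodes0 : Jmodes (fun=> 0).
Proof. by exists (fun=> 0); split=> [T|theta]; rewrite ?mem0v // big1. Qed.

Lemma JmodesP a phi phi' : Jmodes phi -> Jmodes phi' ->
  Jmodes (fun theta => a *: phi theta + phi' theta).
Proof.
move=> [psi [psiJ E]] [psi' [psiJ' E']]; exists (fun T => a *: psi T + psi' T).
split=> [T|theta]; first by rewrite memvD ?memvZ.
by rewrite E E' scaler_sumr -big_split.
Qed.

(** The terms for [T] and [T'] multiply to one for their union, which occurs exactly when both sets
    lie in [theta]. The union has at most [#|T| + #|T'|] elements, so there are enough factors of
    [J]. *)
Lemma Jmodes_mul phi phi' : Jmodes phi -> Jmodes phi' ->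
  Jmodes (fun theta => mul (phi theta) (phi' theta)).
Proof.
move=> [psi [psiJ E]] [psi' [psiJ' E']].
exists (fun R => \sum_(TT | TT.1 :|: TT.2 == R) mul (psi TT.1) (psi' TT.2)).
split=> [R|theta].
  apply: memv_suml => -[T T'] /eqP /= <-; apply: (@Jpow_sub _ (#|T| + #|T'|)).
    by rewrite cardsU leq_subr.
  exact: Jpow_mul.
rewrite E E' (mulv_suml galgV).
under eq_bigr do rewrite (mulv_sumr galgV).
rewrite pair_big /= [LHS](partition_big (fun TT : {set 'I_N} * {set 'I_N} => TT.1 :|: TT.2)
  (fun R => R \subset theta)) /=; last by move=> [T T'] /=; rewrite subUset.
apply: eq_bigr => R Rth; apply: eq_bigl => -[T T'] /=.
by case: eqP => [E2|_]; rewrite ?andbF // andbT -subUset E2.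
Qed.

Lemma Jmodes_var (grp : option 'I_N) u j : (grp -> j \in J) ->
  Jmodes (fun theta => u + (if grp is Some i then if i \in theta then j else 0 else 0)).
Proof.
move=> jJ.
exists (fun T => (if T == set0 then u else 0) +
  (if grp is Some i then if T == [set i] then j else 0 else 0)).
split=> [T|theta].
  apply: memvD; first by case: eqP => [->|_]; rewrite ?cards0 ?memvf ?mem0v.
  case: grp jJ => [i|_]; last exact: mem0v.
  by case: eqP => [->|_] jJ; rewrite ?cards1 ?jJ ?mem0v.
rewrite big_split /= -big_mkcondr /= (big_pred1 set0) => [|T]; last first.
  by apply/andP/eqP => [[_ /eqP]|->] //; rewrite sub0set.
congr (_ + _); case: grp {jJ} => [i|]; last by rewrite big1.
rewrite -big_mkcondr /=; case: ifP => ith.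
  rewrite (big_pred1 [set i]) // => T.
  by apply/andP/eqP => [[_ /eqP]|->] //; rewrite sub1set.
by rewrite big_pred0 // => T; apply/negP => /andP[Tth /eqP TE]; rewrite TE sub1set ith in Tth.
Qed.

(** Inclusion-exclusion: if all values at proper subsets vanish, induction on [#|T|] kills every
    [psi T] with [T] proper, and the value at [setT] is the top term alone. *)
Lemma Jmodes_top phi : Jmodes phi -> (forall theta, theta != setT -> phi theta = 0) ->
  phi setT \in Jpow N.
Proof.
move=> [psi [psiJ E]] phi0.
have psi0 T : T != setT -> psi T = 0.
  have [n] := ubnP #|T|; elim: n T => // n IH T Tn TT.
  have := phi0 T TT; rewrite E (bigD1 T) //= big1 ?addr0 // => T' /andP[T'T T'n].
  have T'p : T' \proper T by rewrite properEneq T'n.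
  apply: IH; first exact: leq_trans (proper_card T'p) Tn.
  by apply: contra TT => /eqP T'E; rewrite eqEsubset subsetT -T'E.
rewrite E (bigD1 setT) ?subsetT //= big1 ?addr0 => [|T /andP[_ /psi0] //].
by have := psiJ setT; rewrite cardsT card_ord.
Qed.

Lemma Jmodes_gpoly (p : gpoly F gT) (u j : nat -> gT -> V) (grp : nat -> gT -> option 'I_N) :
  (forall n h, grp n h -> j n h \in J) ->
  Jmodes (fun theta => eval_gpoly mul (fun n h => u n h +
    (if grp n h is Some i then if i \in theta then j n h else 0 else 0)) p).
Proof.
move=> jJ; pose st (theta : {set 'I_N}) n h :=
  u n h + (if grp n h is Some i then if i \in theta then j n h else 0 else 0).
have ext phi phi' : (forall theta, phi theta = phi' theta) -> Jmodes phi' -> Jmodes phi.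
  by move=> E; rewrite (functional_extensionality _ _ E).
have stJ n h : Jmodes (fun theta => st theta n h) by apply: Jmodes_var => /jJ.
rewrite -/(Jmodes (fun theta => eval_gpoly mul (st theta) p)) /eval_gpoly.
elim: p => [|[a [v w]] p IH].
  by apply: (ext _ _ _ Jmodes0) => theta; rewrite big_nil.
apply: (ext _ _ _ (JmodesP a (phi := fun theta => eval_word mul (st theta) (v, w)) _ IH)).
  by move=> theta; rewrite big_cons.
elim/last_ind: w => [|w z IHw]; first exact: stJ.
apply: (ext _ _ _ (Jmodes_mul IHw (stJ z.1 z.2))) => theta.
by rewrite /eval_word /= foldl_rcons.
Qed.

(** Each grouped variable is split as [s0 l] plus an element of [J], and [theta] lists the groups
    which keep the second summand. [Jmodes_top] then puts the full value into the zero space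
    [Jpow N]. *)
Lemma definable_vanish (L : countType) (deg : L -> gT)
    (Phi : forall R : algType F, (L -> R) -> R) (grp : L -> option 'I_N) (sv s0 : L -> V) :
  (0 < N)%N -> (forall x, x \in Jpow N -> x = 0) -> definable Phi ->
  (forall l, grp l -> sv l - s0 l \in J) ->
  (forall theta : {set 'I_N}, theta != setT ->
     Phi _ (emb mul \o (fun l => if grp l is Some i then if i \in theta then sv l else s0 l
                        else sv l)) = 0) ->
  Phi _ (emb mul \o sv) = 0.
Proof.
move=> N0 JN [e He] svJ Phi0.
have [c [p H]] := expr_gpoly deg e.
pose svt (theta : {set 'I_N}) l :=
  if grp l is Some i then if i \in theta then sv l else s0 l else sv l.
have PhiE theta : Phi _ (emb mul \o svt theta) =
    c%:A + emb mul (eval_gpoly mul (label_val deg (svt theta)) p).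
  by rewrite He (H _ _ _ galgV _ _ (label_valE deg _)).
(* The empty set is a proper subset because [0 < N], so the hypothesis applies to it. *)
have c0 : c = 0.
  have := Phi0 set0; rewrite PhiE => /(_ _)/(algebra_const0 (emb00 _ _)); apply.
  by apply/eqP => /setP/(_ (Ordinal N0)); rewrite !inE.
pose u n h := if unpickle n is Some l then if deg l == h then
  if grp l is Some _ then s0 l else sv l else 0 else 0 : V.
pose j n h := if unpickle n is Some l then if deg l == h then sv l - s0 l else 0 else 0 : V.
pose grp' n (h : gT) := if unpickle n is Some l then if deg l == h then grp l else None else None.
have lvE theta : label_val deg (svt theta) = fun n h => u n h +
    (if grp' n h is Some i then if i \in theta then j n h else 0 else 0).
  apply: functional_extensionality => n; apply: functional_extensionality => h.
  rewrite /label_val /u /j /grp' /svt; case: unpickle => [l|]; last by rewrite addr0.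
  case: eqP => _; last by rewrite addr0.
  case: (grp l) => [i|]; last by rewrite addr0.
  by case: ifP; rewrite ?addr0 // addrC subrK.
have svT : sv = svt setT.
  by apply: functional_extensionality => l; rewrite /svt; case: (grp l) => // i; rewrite inE.
have jJ n h : grp' n h -> j n h \in J.
  by rewrite /grp' /j; case: unpickle => // l; case: eqP => // _ /svJ.
have := Jmodes_top (Jmodes_gpoly p u jJ).
rewrite [in Phi _ _]svT PhiE c0 scale0r add0r lvE => Hz.
rewrite (JN _ (Hz _)) ?(emb0 galgV) // => theta /Phi0.
by rewrite PhiE c0 scale0r add0r -lvE => /emb_inj.
Qed.
End Modes.
End NilpotentCounting.
End Expressions.

(** * Alternating blocks and trace operators *)

Section ProductLemmas.
Variables (F : fieldType) (R : algType F).

Lemma prodr_linear_at (I : eqType) (r : seq I) (P : pred I) j0 (A B C : I -> R) a :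
  uniq r -> j0 \in r -> P j0 -> (forall j, j != j0 -> B j = A j /\ C j = A j) ->
  A j0 = a *: B j0 + C j0 ->
  \prod_(j <- r | P j) A j = a *: \prod_(j <- r | P j) B j + \prod_(j <- r | P j) C j.
Proof.
move=> ur jr Pj AE Aj0; elim: r ur jr => //= j r IH /andP[jr ur].
rewrite inE !big_cons; have [jE _|jj0 /= j0r] := eqVneq j0 j.
  subst j.
  have E (D : I -> R) : (forall i, i != j0 -> D i = A i) ->
      \prod_(i <- r | P i) D i = \prod_(i <- r | P i) A i.
    move=> H; rewrite big_seq_cond [RHS]big_seq_cond; apply: eq_bigr => i /andP[ir _].
    by rewrite H //; apply: contraNneq jr => <-.
  rewrite Pj Aj0 (E B) ?(E C) => [|i /AE[]|i /AE[]] //.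
  by rewrite mulrDl scalerAl.
have [-> ->] : B j = A j /\ C j = A j by apply: AE; rewrite eq_sym.
case: (P j); rewrite (IH ur j0r) //.
by rewrite mulrDr scalerAr.
Qed.

Lemma prodr_scale_absorb (I : Type) (r : seq I) (P : pred I) (a : I -> F) (A : I -> R) (w : R) :
  (forall i, P i -> A i * w = a i *: w) ->
  (\prod_(i <- r | P i) A i) * w = (\prod_(i <- r | P i) a i) *: w.
Proof.
move=> H; elim: r => [|i r IH]; first by rewrite !big_nil mul1r scale1r.
rewrite !big_cons; case: ifP => Pi //.
by rewrite -mulrA IH -scalerAr H // scalerA mulrC.
Qed.

Lemma prodr_scale (I : Type) (r : seq I) (P : pred I) (a : I -> F) (A : I -> R) :
  \prod_(i <- r | P i) (a i *: A i) =
  (\prod_(i <- r | P i) a i) *: \prod_(i <- r | P i) A i.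
Proof.
elim: r => [|i r IH]; first by rewrite !big_nil scale1r.
rewrite !big_cons; case: ifP => Pi //.
by rewrite IH -scalerAl -scalerAr scalerA.
Qed.

End ProductLemmas.

Lemma upd_comm (I : eqType) (X : Type) (z : I -> X) i j x y : i != j ->
  (fun k => if k == j then y else (fun k => if k == i then x else z k) k) =
  (fun k => if k == i then x else (fun k => if k == j then y else z k) k).
Proof.
move=> ij; apply: functional_extensionality => k.
by case: eqP => // ->; rewrite eq_sym (negPf ij).
Qed.

Section BlockOperators.
Variables (F : fieldType) (gT : finGroupType) (N d r : nat) (g : 'I_d -> gT).
Variable ms : seq (seq 'I_r).

Section OverAlgebra.
Variable R : algType F.
Implicit Types (zeta : 'I_N -> 'I_d -> R) (G H : ('I_N -> 'I_d -> R) -> R) (z : 'I_d -> R).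

Definition block_multilinear i G := forall zeta, multilinear (fun z => G (upd zeta i z)).

(** Alternation in block [i], in the form used below: a degree-preserving linear substitution in the
    block acts through its determinant. *)
Definition block_det i G := forall zeta z (c : 'M[F]_d),
  (forall k l, g k != g l -> c k l = 0) ->
  G (upd zeta i (fun k => \sum_l c k l *: z l)) = \det c *: G (upd zeta i z).

(** The operator is a linear combination of substitutions inside block [j] alone, so it preserves
    multilinearity, alternation and vanishing in any other block. *)
Definition block_op j (H : (('I_N -> 'I_d -> R) -> R) -> ('I_N -> 'I_d -> R) -> R) :=
  exists L : seq (F * (('I_d -> R) -> 'I_d -> R)), forall G zeta,
    H G zeta = \sum_(p <- L) p.1 *: G (upd zeta j (p.2 (zeta j))).

Lemma updC zeta i j z z' : i != j ->
  upd (upd zeta i z) j z' = upd (upd zeta j z') i z.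
Proof. exact: upd_comm. Qed.

Lemma upd_neq zeta i j z : i != j -> upd zeta i z j = zeta j.
Proof. by rewrite /upd eq_sym => /negPf ->. Qed.

Lemma block_op_multilinear i j Op G : i != j -> block_op j Op ->
  block_multilinear i G -> block_multilinear i (Op G).
Proof.
move=> ij [L LE] mG zeta z k a x y; rewrite !LE scaler_sumr -big_split /=.
apply: eq_bigr => p _; rewrite !upd_neq // !(updC _ _ _ ij) mG.
by rewrite scalerDr !scalerA mulrC.
Qed.

Lemma block_op_det i j Op G : i != j -> block_op j Op ->
  block_det i G -> block_det i (Op G).
Proof.
move=> ij [L LE] dG zeta z c cg; rewrite !LE scaler_sumr.
apply: eq_bigr => p _; rewrite !upd_neq // !(updC _ _ _ ij) dG //.
by rewrite !scalerA mulrC.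
Qed.

Lemma block_op_vanish i j Op G (D : ('I_d -> R) -> Prop) : i != j -> block_op j Op ->
  (forall zeta, D (zeta i) -> G zeta = 0) -> forall zeta, D (zeta i) -> Op G zeta = 0.
Proof.
move=> ij [L LE] G0 zeta Dz; rewrite LE big1 // => p _.
by rewrite G0 ?scaler0 // upd_neq // eq_sym.
Qed.

Definition alt_block i G zeta := altsum g (fun z => G (upd zeta i z)) (zeta i).

Lemma alt_block_op i : block_op i (alt_block i).
Proof.
exists [seq ((-1) ^+ s, fun z k => z (s k)) | s : 'S_d <- enum [pred s : 'S_d | pres g (pval s)]].
by move=> G zeta; rewrite /alt_block /altsum big_map big_enum /=; apply: eq_bigl => s; rewrite inE.
Qed.

Lemma alt_block_det i G : block_multilinear i G -> block_det i (alt_block i G).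
Proof.
move=> mG zeta z c cg; rewrite /alt_block !upd_eq.
have E z' : (fun z => G (upd (upd zeta i z') i z)) = fun z => G (upd zeta i z).
  by apply: functional_extensionality => z0; rewrite upd_upd.
by rewrite !E; apply: altsum_det.
Qed.

Variable x : 'I_N -> 'I_r -> R.

Definition trace_word i n := \prod_(j <- nth [::] ms n) x i j.

Definition trace_op i n G zeta := if (n < size ms)%N then
  \sum_k G (upd zeta i (upd (zeta i) k (trace_word i n * zeta i k))) else 0.

(* The operators trace_op i n multiply by a trace on semisimple arguments, so op i t
   multiplies by the value of the term t at these traces. *)
Fixpoint op i (t : GRing.term F) G {struct t} := 
  match t with
  | GRing.Var n => trace_op i n G
  | GRing.Const c => fun zeta => c *: G zeta
  | GRing.NatConst n => fun zeta => n%:R *: G zeta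
  | GRing.Add a b => fun zeta => op i a G zeta + op i b G zeta
  | GRing.Opp a => fun zeta => (-1) *: op i a G zeta
  | GRing.NatMul a n => fun zeta => n%:R *: op i a G zeta
  | GRing.Mul a b => op i a (op i b G)
  | GRing.Exp a n => iter n (op i a) G
  | _ => fun=> 0
  end.

Lemma block_op_comp i A B : block_op i A -> block_op i B -> block_op i (fun G => A (B G)).
Proof.
move=> [L LE] [L' LE'].
exists [seq (p.1 * p'.1, fun z => p'.2 (p.2 z)) | p <- L, p' <- L'] => G zeta.
rewrite LE big_allpairs_dep; apply: eq_bigr => p _.
rewrite LE' scaler_sumr; apply: eq_bigr => p' _.
by rewrite upd_eq upd_upd scalerA.
Qed.

Lemma block_op_scale i a A : block_op i A -> block_op i (fun G zeta => a *: A G zeta).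
Proof.
move=> [L LE]; exists [seq (a * p.1, p.2) | p <- L] => G zeta.
by rewrite LE big_map scaler_sumr; apply: eq_bigr => p _; rewrite scalerA.
Qed.

Lemma block_op_id i : block_op i id.
Proof.
exists [:: (1, id)] => G zeta.
by rewrite big_seq1 scale1r upd_id.
Qed.

Lemma op_block_op i t : block_op i (op i t).
Proof.
elim: t => /= [n|c|n|a [La Ha] b [Lb Hb]|a Ha|a Ha n|a Ha b Hb|a _|a Ha n].
- exists (if (n < size ms)%N then [seq (1, fun z => upd z k (trace_word i n * z k)) | k <- enum 'I_d]
          else [::]) => G zeta.
  rewrite /trace_op; case: ifP => _; last by rewrite big_nil.
  by rewrite big_map big_enum; apply: eq_bigr => k _; rewrite scale1r.
- exact: block_op_scale (block_op_id i).
- exact: block_op_scale (block_op_id i).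
- by exists (La ++ Lb) => G zeta; rewrite big_cat Ha Hb.
- exact: block_op_scale.
- exact: block_op_scale.
- exact: block_op_comp.
- by exists [::] => G zeta; rewrite big_nil.
elim: n => [|n IH] /=; first exact: block_op_id.
exact: block_op_comp.
Qed.

Definition alts (s : seq 'I_N) G := foldr alt_block G s.
Definition ops t (s : seq 'I_N) G := foldr (fun i => op i t) G s.

Lemma alts_multilinear i s G : i \notin s -> block_multilinear i G ->
  block_multilinear i (alts s G).
Proof.
move=> + mG; elim: s => //= j s IH; rewrite inE negb_or => /andP[ij /IH].
exact/block_op_multilinear/alt_block_op.
Qed.

Lemma alts_det i s G : i \in s -> uniq s -> block_multilinear i G -> block_det i (alts s G).
Proof.
move=> + + mG; elim: s => //= j s IH; rewrite inE => + /andP[js us].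
case: (eqVneq i j) => [<-|ij] in js * => [_|/IH]; last first.
  by move=> /(_ us); apply/block_op_det/alt_block_op.
by apply: alt_block_det; apply: alts_multilinear.
Qed.

Lemma ops_det i t s G : i \notin s -> block_det i G -> block_det i (ops t s G).
Proof.
move=> + dG; elim: s => //= j s IH; rewrite inE negb_or => /andP[ij /IH].
exact/block_op_det/op_block_op.
Qed.

End OverAlgebra.

Section Values.
Variables (V : vectType F) (mul : V -> V -> V) (gr : gT -> {vspace V}).
Hypothesis galgV : galg mul gr.
Variables (S : {vspace V}) (e : 'I_d -> V).
Hypotheses (hb : hbasis gr S g e) (Smul : mul_closed mul S).
Let R := 'M[F]_((dim V).+1) : algType F.
Let em : V -> R := emb mul.

Definition ss_block (z : 'I_d -> R) := exists z' : 'I_d -> V,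
  forall k, [/\ z k = em (z' k), z' k \in S & z' k \in gr (g k)].

Definition wprod (x : 'I_r -> V) (w : seq 'I_r) : V :=
  if w is a :: w' then foldl (fun y j => mul y (x j)) (x a) w' else 0.

Definition trace_env (x : 'I_r -> V) := [seq tr mul e (wprod x w) | w <- ms].

Lemma emb_wprod x w : w != [::] -> em (wprod x w) = \prod_(j <- w) em (x j).
Proof.
case: w => // a w _ /=; rewrite big_cons; move: (x a) => y.
elim: w y => [|j w IH] y /=; first by rewrite big_nil mulr1.
by rewrite IH big_cons mulrA /em (embM galgV).
Qed.

Lemma ss_block_e : ss_block (fun k => em (e k)).
Proof. by exists e => k; split; rewrite ?(hb_mem hb) ?(hb_gr hb). Qed.

(** With [z = C e] and [U] the matrix of left multiplication by [u], replacing [z k] by [u z k]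
    replaces row [k] of [C] by that of [C U]. As [u] has degree 1, these matrices respect degrees;
    [block_det] and [sum_det_replace_row] finish. *)
Lemma trace_replace i (G : ('I_N -> 'I_d -> R) -> R) zeta z u : block_det i G ->
  ss_block z -> u \in S -> u \in gr 1%g ->
  \sum_k G (upd zeta i (upd z k (em u * z k))) = tr mul e u *: G (upd zeta i z).
Proof.
move=> dG [z' zE] uS u1.
pose C := \matrix_(k, l) cf e l (z' k).
have Cg k l : g k != g l -> C k l = 0.
  by case: (zE k) => _ zS zg kl; rewrite mxE (hb_supp galgV hb zS zg) // eq_sym.
have su : stab mul S u by move=> y; apply: Smul.
have zC : z = fun k => \sum_l C k l *: em (e l).
  apply: functional_extensionality => k; case: (zE k) => -> zS _.
  rewrite {1}(hb_expand hb zS) /em (emb_sum galgV); apply: eq_bigr => l _.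
  by rewrite (embZ galgV) mxE.
pose U := reg mul e u.
have uz k : em u * z k = \sum_l (C *m U) k l *: em (e l).
  case: (zE k) => -> zS _; rewrite /em -(embM galgV).
  rewrite {1}(hb_expand hb zS) (mulv_sumr galgV).
  under eq_bigr do rewrite (mulvZr galgV) (reg_expand hb _ su) scaler_sumr.
  rewrite exchange_big (emb_sum galgV); apply: eq_bigr => l _.
  rewrite (emb_sum galgV) mxE scaler_suml; apply: eq_bigr => m _.
  by rewrite !(embZ galgV) scalerA !mxE.
have Ug k l : g k != g l -> U k l = 0.
  move=> kl; rewrite mxE; apply: (hb_supp galgV hb (h := g k)); last by rewrite eq_sym.
    exact/Smul/(hb_mem hb).
  by have := mul_gr galgV u1 (hb_gr hb k); rewrite mul1g.
have CUg k l : g k != g l -> (C *m U) k l = 0.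
  move=> kl; rewrite mxE big1 // => m _; have [km|km] := eqVneq (g k) (g m).
    by rewrite Ug ?mulr0 // -km.
  by rewrite Cg ?mul0r.
pose Ck k := \matrix_(i, j) if i == k then (C *m U) i j else C i j.
have E k : upd z k (em u * z k) = fun m => \sum_l Ck k m l *: em (e l).
  apply: functional_extensionality => m; rewrite /upd.
  case: (m =P k) => [->|/eqP/negPf mk].
    by rewrite uz; apply: eq_bigr => l _; rewrite [Ck _ _ _]mxE eqxx.
  by rewrite zC; apply: eq_bigr => l _; rewrite [Ck _ _ _]mxE mk.
rewrite {3}zC (dG _ _ _ Cg).
under eq_bigr => k _.
  rewrite E dG; last first.
    by move=> m l ml; rewrite mxE; case: ifP => _; rewrite ?CUg ?Cg.
  over.
by rewrite -scaler_suml sum_det_replace_row scalerA trE.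
Qed.

Hypothesis ms_neq0 : forall w, w \in ms -> w != [::].

(** [G] is only assumed to agree with a multiple of the alternating [H] on semisimple blocks.
    Exactly this survives an application of [op], so products and powers of terms can be handled by
    iteration. *)
Lemma op_value i t (x : 'I_N -> 'I_r -> R) (x' : 'I_r -> V) :
  GRing.rterm t -> (forall j, x i j = em (x' j)) ->
  (forall w, w \in ms -> wprod x' w \in S /\ wprod x' w \in gr 1%g) ->
  forall zeta (G H : ('I_N -> 'I_d -> R) -> R) c, block_det i H ->
  (forall z, ss_block z -> G (upd zeta i z) = c *: H (upd zeta i z)) ->
  forall z, ss_block z ->
  op x i t G (upd zeta i z) = (GRing.eval (trace_env x') t * c) *: H (upd zeta i z).
Proof.
move=> + xE wS zeta; elim: t => /= [n|a|n|a IHa b IHb|a IHa|a IHa n|a IHa b IHb|a _|a IHa n] // rt G H c dH GE z zS.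
- rewrite /trace_op; case: ltnP => ns; last first.
    by rewrite nth_default ?size_map // mul0r scale0r.
  rewrite upd_eq (nth_map [::]) //.
  have wm : nth [::] ms n \in ms by rewrite mem_nth.
  have uE : trace_word x i n = em (wprod x' (nth [::] ms n)).
    by rewrite emb_wprod ?ms_neq0 //; apply: eq_bigr => j _; rewrite xE.
  have [wS' w1] := wS _ wm.
  rewrite mulrC -scalerA -(trace_replace _ dH zS wS' w1) scaler_sumr.
  apply: eq_bigr => k _; rewrite upd_upd uE GE //.
  have [z' zE] := zS.
  exists (upd z' k (mul (wprod x' (nth [::] ms n)) (z' k))) => l; rewrite /upd.
  case: (l =P k) => [->|_]; last exact: zE.
  have [-> z'S z'g] := zE k; rewrite /em (embM galgV) Smul //; split=> //.
  by have := mul_gr galgV w1 z'g; rewrite mul1g.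
- by rewrite GE // scalerA.
- by rewrite GE // scalerA.
- by case/andP: rt => ra rb; rewrite (IHa ra _ _ _ dH GE) // (IHb rb _ _ _ dH GE) // mulrDl scalerDl.
- by rewrite (IHa rt _ _ _ dH GE) // scalerA mulNr mul1r -mulNr.
- by rewrite (IHa rt _ _ _ dH GE) // scalerA mulrA mulr_natl.
- case/andP: rt => ra rb.
  by rewrite (IHa ra _ _ _ dH (IHb rb _ _ _ dH GE)) // mulrA.
elim: n z zS => [|n IHn] z zS /=; first by rewrite GE // expr0 mul1r.
by rewrite (IHa rt _ _ _ dH IHn) // exprS mulrA.
Qed.

(** The operator of block [i] multiplies by the value of [t], which is 0; the operators of the other
    blocks keep the vanishing. *)
Lemma ops_vanish i t s (x : 'I_N -> 'I_r -> R) (x' : 'I_r -> V) (G : ('I_N -> 'I_d -> R) -> R) :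
  GRing.rterm t -> (forall j, x i j = em (x' j)) ->
  (forall w, w \in ms -> wprod x' w \in S /\ wprod x' w \in gr 1%g) ->
  GRing.eval (trace_env x') t = 0 -> i \in s -> uniq s -> block_det i G ->
  forall zeta, ss_block (zeta i) -> ops x t s G zeta = 0.
Proof.
move=> rt xE wS t0 + + dG; elim: s => //= j s IH; rewrite inE => + /andP[js us].
case: (eqVneq i j) => [<-|ij] in js * => [_|/IH]; last first.
  by move=> /(_ us) H; apply: (block_op_vanish (D := ss_block) ij (op_block_op x j t)).
move=> zeta zS; rewrite -(upd_id zeta i).
rewrite (op_value rt xE wS (H := ops x t s G) (c := 1)) ?t0 ?mul0r ?scale0r //.
  exact: ops_det.
by move=> z _; rewrite scale1r.
Qed.

Lemma ops_value t s (x : 'I_N -> 'I_r -> R) (x' : 'I_r -> V) (G : ('I_N -> 'I_d -> R) -> R) :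
  GRing.rterm t -> (forall i j, x i j = em (x' j)) ->
  (forall w, w \in ms -> wprod x' w \in S /\ wprod x' w \in gr 1%g) ->
  uniq s -> (forall i, i \in s -> block_det i G) ->
  forall zeta, (forall i, ss_block (zeta i)) ->
  ops x t s G zeta = GRing.eval (trace_env x') t ^+ size s *: G zeta.
Proof.
move=> rt xE wS us dG; elim: s us dG => [_ _ zeta _|j s IH]; first by rewrite scale1r.
move=> /= /andP[js us] dG zeta zS; rewrite -(upd_id zeta j).
rewrite (op_value rt (xE j) wS (H := G) (c := GRing.eval (trace_env x') t ^+ size s)) //.
- by rewrite exprS.
- by apply: dG; rewrite mem_head.
move=> z zz; apply: IH => // [i si|i]; first by apply: dG; rewrite inE si orbT.
by rewrite /upd; case: eqP.
Qed.

(** A linear relation [a] within one degree gives a degree-preserving singular matrix [c] that fixes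
    [z], so the value is multiplied by [\det c = 0]. *)
Lemma block_det_dependent i (G : ('I_N -> 'I_d -> R) -> R) zeta (z : 'I_d -> R)
    (a : 'rV[F]_d) h : block_det i G ->
  (forall k, g k != h -> a 0 k = 0) -> a != 0 -> \sum_k a 0 k *: z k = 0 ->
  G (upd zeta i z) = 0.
Proof.
move=> dG ah a0 az; have [k0 ak0] : exists k, a 0 k != 0.
  by apply/existsP; apply: contraNT a0; rewrite negb_exists => /forallP H;
    apply/eqP/rowP=> k; rewrite mxE; apply/eqP; have := H k; rewrite negbK.
(* [c] subtracts from [z k0] the relation scaled by the inverse of [a 0 k0], which does not change
   [z]; and [a] is in the left kernel of [c]. *)
pose c := 1%:M - delta_mx k0 0 *m ((a 0 k0)^-1 *: a) : 'M[F]_d.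
have cE k l : c k l = (k == l)%:R - (k == k0)%:R * ((a 0 k0)^-1 * a 0 l).
  by rewrite !mxE big_ord1 !mxE eqxx andbT.
have cz : (fun k => \sum_l c k l *: z l) = z.
  apply: functional_extensionality => k.
  under eq_bigr do rewrite cE scalerBl -!scalerA.
  rewrite sumrB -!scaler_sumr az !scaler0 subr0 (bigD1 k) //= eqxx scale1r.
  by rewrite big1 ?addr0 // => l lk; rewrite eq_sym (negPf lk) scale0r.
have cg k l : g k != g l -> c k l = 0.
  move=> kl; rewrite cE; case: (k =P l) kl => [->|_ kl]; first by rewrite eqxx.
  case: (k =P k0) => [kk0|_]; last by rewrite mul0r subrr.
  have gk0 : g k0 = h by apply/eqP; apply: contraNT ak0 => /ah ->.
  have al : a 0 l = 0 by apply: ah; rewrite -gk0 -kk0 eq_sym.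
  by rewrite al !mulr0 subrr.
have -> : G (upd zeta i z) = \det c *: G (upd zeta i z) by rewrite -dG ?cz.
suff /det0P/eqP -> : exists2 v : 'rV_d, v != 0 & v *m c = 0 by rewrite scale0r.
exists a => //; apply/rowP=> l; rewrite mxE.
under eq_bigr do rewrite cE mulrBr.
rewrite sumrB (bigD1 l) //= eqxx mulr1 big1 ?addr0; last first.
  by move=> k /negPf ->; rewrite mulr0.
rewrite (bigD1 k0) //= eqxx mul1r mulVKf // big1 ?addr0 ?mxE ?subrr //.
by move=> k /negPf ->; rewrite mul0r mulr0.
Qed.

End Values.
End BlockOperators.

(** * The polynomial of a full algebra *)

Section FullPolynomial.
Variables (F : fieldType) (gT : finGroupType) (N d r q : nat).
Variables (g : 'I_d -> gT) (ix : 'I_d -> 'I_q) (sq : {perm 'I_q}).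
Variable ms : seq (seq 'I_r).

Section Word.
Variable R : algType F.
Variables (y : 'I_d -> R) (y' : 'I_d -> 'I_d -> R) (v : 'I_q -> R).

(** The left side of [coordinate_extraction] as a polynomial: [y l] stands for [e l], and [y' k l]
    for the scaled product of [b k] and [b l]. *)
Definition extract k (a : R) := \sum_l y l * a * y' k l.

Definition segment (zeta : 'I_N -> 'I_d -> R) m i :=
  \prod_(k < d | ix k == sq m) extract k (zeta i k).

(** For every block, component [sq m] processes the variables indexed by its own basis vectors;
    [v m] then leads on to the next component. *)
Definition word (zeta : 'I_N -> 'I_d -> R) :=
  \prod_(m < q) ((\prod_(i < N) segment zeta m i) * v m).

Lemma extractP k c a b : extract k (c *: a + b) = c *: extract k a + extract k b.
Proof.
rewrite /extract scaler_sumr -big_split /=; apply: eq_bigr => l _.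
by rewrite mulrDr mulrDl -scalerAr -scalerAl.
Qed.

(** The variable [zeta i k] occurs in exactly one place: factor [m0], the preimage of [ix k] under
    [sq], then block [i], then position [k]. Each of the three nested products is handled by
    [prodr_linear_at]. *)
Lemma word_multilinear i : block_multilinear i word.
Proof.
move=> zeta k z c a b; pose m0 := (sq^-1)%g (ix k).
have mE m : (ix k == sq m) = (m == m0).
  by rewrite /m0 eq_sym -(inj_eq (@perm_inj _ sq) m) permKV.
have other (w : R) m j : (m != m0) || (j != i) ->
    segment (upd zeta i (upd z k w)) m j = segment (upd zeta i z) m j.
  move=> mj; apply: eq_bigr => l lm; congr (extract l _); rewrite /upd.
  case: (j =P i) mj => [ji|] //; rewrite orbF; case: (l =P k) => [lk|//].
  by rewrite -mE -lk lm.
rewrite /word; apply: (prodr_linear_at (j0 := m0)).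
- exact: index_enum_uniq.
- by rewrite mem_index_enum.
- by [].
- move=> m mm0; split; congr (_ * _); apply: eq_bigr => j _; rewrite !other ?mm0 //.
rewrite scalerAl -mulrDl; congr (_ * _).
apply: (prodr_linear_at (j0 := i)).
- exact: index_enum_uniq.
- by rewrite mem_index_enum.
- by [].
- by move=> j ji; rewrite !other ?ji ?orbT.
apply: (prodr_linear_at (j0 := k)).
- exact: index_enum_uniq.
- by rewrite mem_index_enum.
- by rewrite mE.
- by move=> l /negPf lk; rewrite /upd eqxx lk.
by rewrite /upd !eqxx extractP.
Qed.

End Word.

Definition label : countType := ('I_N * 'I_d + 'I_N * 'I_r + 'I_d + 'I_d * 'I_d + 'I_q)%type.
Definition lz i k : label := inl (inl (inl (inl (i, k)))).
Definition lx i j : label := inl (inl (inl (inr (i, j)))).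
Definition ly l : label := inl (inl (inr l)).
Definition ly' k l : label := inl (inr (k, l)).
Definition lv m : label := inr m.

Definition label_case (X : Type) (fz : 'I_N -> 'I_d -> X) (fx : 'I_N -> 'I_r -> X)
    (fy : 'I_d -> X) (fy' : 'I_d -> 'I_d -> X) (fv : 'I_q -> X) (l : label) : X :=
  match l with
  | inl (inl (inl (inl (i, k)))) => fz i k
  | inl (inl (inl (inr (i, j)))) => fx i j
  | inl (inl (inr l)) => fy l
  | inl (inr (k, l)) => fy' k l
  | inr m => fv m
  end.

(** Group [i] joins the block [z_i] with its own copy [x_i] of the trace arguments, so a semisimple
    group [i] makes [op] at [i] a multiplication by traces. *)
Definition label_group : label -> option 'I_N :=
  label_case (fun i _ => Some i) (fun i _ => Some i) (fun=> None) (fun _ _ => None) (fun=> None).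

Definition word_at (R : algType F) (x : label -> R) :=
  word (fun l => x (ly l)) (fun k l => x (ly' k l)) (fun m => x (lv m)).

Definition alt_word (R : algType F) (x : label -> R) :=
  alts g (enum 'I_N) (word_at x).

Definition fullpoly (t : GRing.term F) (R : algType F) (x : label -> R) : R :=
  ops ms (fun i j => x (lx i j)) t (enum 'I_N) (alt_word x) (fun i k => x (lz i k)).

(** The operators substitute products into blocks, so definability has to be kept for all definable
    block arguments. *)
Definition good (G : forall R : algType F, (label -> R) -> ('I_N -> 'I_d -> R) -> R) :=
  forall zeta : forall R : algType F, (label -> R) -> 'I_N -> 'I_d -> R,
  (forall i k, definable (fun R x => zeta R x i k)) ->
  definable (fun R x => G R x (zeta R x)).

Lemma definable_upd (zeta : forall R : algType F, (label -> R) -> 'I_N -> 'I_d -> R)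
  (z : forall R : algType F, (label -> R) -> 'I_d -> R) j :
  (forall i k, definable (fun R x => zeta R x i k)) ->
  (forall k, definable (fun R x => z R x k)) ->
  forall i k, definable (fun R x => upd (zeta R x) j (z R x) i k).
Proof.
by move=> dz dz' i k; rewrite /upd; case: (i == j); [apply: dz' | apply: dz].
Qed.

Lemma good_word : good (fun R x => word_at x).
Proof.
move=> zeta dz; rewrite /word_at /word /segment /extract.
apply: definable_prod => m _; apply: definableM; last exact: definable_var.
apply: definable_prod => i _; apply: definable_prod => k _.
apply: definable_sum => l _; apply: definableM; last exact: definable_var.
by apply: definableM; first exact: definable_var.
Qed.

Lemma good_alts G s : good G -> good (fun R x => alts g s (G R x)).
Proof.
move=> gG; elim: s => //= i s IH zeta dz.
rewrite /alt_block /altsum; apply: definable_sum => p _; apply: definableZ.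
apply: (IH (fun R x => upd (zeta R x) i (fun k => zeta R x i (p k)))).
exact: (definable_upd (z := fun R x k => zeta R x i (p k))).
Qed.

Lemma good_op G i t : good G -> good (fun R x => op ms (fun i j => x (lx i j)) i t (G R x)).
Proof.
elim: t G => /= [n|c|n|a IHa b IHb|a IHa|a IHa n|a IHa b IHb|a _|a IHa n] G gG zeta dz.
- rewrite /trace_op; case: (n < size ms)%N; last exact: definable0.
  apply: definable_sum => k _.
  apply: (gG (fun R x => upd (zeta R x) i (upd (zeta R x i) k
    (trace_word ms (fun i j => x (lx i j)) i n * zeta R x i k)))).
  apply: (definable_upd (z := fun R x => upd (zeta R x i) k
    (trace_word ms (fun i j => x (lx i j)) i n * zeta R x i k))) => // l.
  rewrite /upd; case: (l == k); last exact: dz.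
  apply: definableM => //; apply: definable_prod => j _; exact: definable_var.
- exact/definableZ/gG.
- exact/definableZ/gG.
- by apply: definableD; [apply: IHa | apply: IHb].
- by apply: definableZ; apply: IHa.
- by apply: definableZ; apply: IHa.
- exact: (IHa _ (IHb _ gG)).
- exact: definable0.
by elim: n zeta dz => [|n IHn]; [apply: gG | apply: IHa].
Qed.

Lemma definable_fullpoly t : definable (fullpoly t).
Proof.
have gA : good (fun R x => alt_word x) by apply/good_alts/good_word.
have gO s : good (fun R x => ops ms (fun i j => x (lx i j)) t s (alt_word x)).
  by elim: s => //= i s IH; apply: good_op.
by apply: (gO _ (fun R x i k => x (lz i k))) => i k; apply: definable_var.
Qed.

Lemma fullpoly_const1 (R : algType F) (x : label -> R) :
  fullpoly (GRing.Const 1) x = alt_word x (fun i k => x (lz i k)).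
Proof.
rewrite /fullpoly; elim: (enum 'I_N) (fun i k => _) => //= i s IH zeta.
by rewrite scale1r IH.
Qed.

Lemma alt_word_det (R : algType F) (x : label -> R) i : block_det g i (alt_word x).
Proof.
by apply: alts_det; rewrite ?mem_enum ?enum_uniq //; apply: word_multilinear.
Qed.

End FullPolynomial.

(** * Nonzero values of the polynomial on a full algebra *)

Section FullAlgebra.
Variables (F : closedFieldType) (gT : finGroupType) (V : vectType F).
Hypothesis charF : [pchar F] =i pred0.
Variables (mul : V -> V -> V) (gr : gT -> {vspace V}).
Hypothesis galgV : galg mul gr.
Variables (J : {vspace V}) (q : nat) (Ai : 'I_q -> {vspace V}).
Hypothesis WM : graded_WM mul gr J Ai.
Let S := (\sum_(i < q) Ai i)%VS.
Variables (d : nat) (g : 'I_d -> gT) (e : 'I_d -> V) (ix : 'I_d -> 'I_q).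
Hypotheses (hb : hbasis gr S g e) (eix : forall k, e k \in Ai (ix k)).
Local Notation t := (tr mul e).
Local Notation em := (emb mul).

Variables (un : 'I_q -> V) (b : 'I_d -> V).
Hypothesis unP : forall i, [/\ un i \in Ai i, un i \in gr 1%g &
    forall x, x \in Ai i -> mul (un i) x = x /\ mul x (un i) = x].
Hypotheses (bA : forall k, b k \in Ai (ix k)) (bg : forall k, b k \in gr (g k)^-1%g)
  (tb : forall m k, t (mul (e m) (b k)) = (m == k)%:R).

(** Each [a_k] is merged with the radical element after it, and the last one stands alone. Splitting
    these factors into homogeneous components expands the product over all choices of degrees, so
    some choice is nonzero. *)
Lemma full_homogeneous : full mul J Ai ->
  exists (s : {perm 'I_q}) (hv : 'I_q -> gT) (v : 'I_q -> V),
  [/\ (0 < q)%N, forall m, v m \in gr (hv m), forall m, mul (un (s m)) (v m) = v m &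
      \prod_(m < q) em (v m) != 0].
Proof.
move=> [s [a [j [q0 aA jJ nz]]]].
pose w k := if (k < q.-1)%N then mul (a k) (j k) else a k.
have wE (m : 'I_q) : mul (un (s m)) (w m) = w m.
  have [_ _ uE] := unP (s m); rewrite /w; case: ifP => _; last exact: (uE _ (aA m)).1.
  by rewrite (mulvA galgV) (uE _ (aA m)).1.
have prodE k : (k <= q.-1)%N -> em (altprod mul a j k) =
    (\prod_(m < k) em (w m)) * em (a k).
  elim: k => [_|k IH kq] /=; first by rewrite big_ord0 mul1r.
  rewrite !(embM galgV) IH ?(ltnW kq) // big_ord_recr /= /w kq.
  by rewrite (embM galgV) !mulrA.
have nzw : \prod_(m < q) em (w m) != 0.
  have -> : \prod_(m < q) em (w m) = \prod_(0 <= m < q.-1.+1) em (w m).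
    by rewrite prednK // big_mkord.
  rewrite big_mkord big_ord_recr /= {2}/w ltnn -prodE //.
  by apply: contra nz => /eqP/emb_inj ->.
have ex (m : 'I_q) : exists c : {ffun gT -> V}, (forall h, c h \in gr h /\
    mul (un (s m)) (c h) = c h) /\ w m = \sum_h c h.
  have [c cM wc] := graded_subP (fullv_graded galgV) (memvf (w m)).
  have [uA u1 uE] := unP (s m).
  exists [ffun h => mul (un (s m)) (c h)]; split=> [h|].
    rewrite ffunE (mulvA galgV) (uE _ uA).1; split=> //.
    by have /memv_capP[_ ch] := cM h; have := mul_gr galgV u1 ch; rewrite mul1g.
  by rewrite -wE wc (mulv_sumr galgV); apply: eq_bigr => h _; rewrite ffunE.
have [c cP] := fin_all_exists ex.
have : \sum_(f : {ffun 'I_q -> gT}) \prod_(m < q) em (c m (f m)) != 0.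
  rewrite -(bigA_distr_bigA (fun m h => em (c m h))).
  apply: contra nzw => /eqP E; rewrite -[X in _ == X]E; apply/eqP.
  by apply: eq_bigr => m _; rewrite (cP m).2 (emb_sum galgV).
have [f fnz _|f0] := pickP (fun f : {ffun 'I_q -> gT} => \prod_(m < q) em (c m (f m)) != 0).
  by exists s, f, (fun m => c m (f m)); split=> // m; case: ((cP m).1 (f m)).
by rewrite big1 ?eqxx // => f _; apply/eqP; have := f0 f; case: eqP.
Qed.

Variables (s : {perm 'I_q}) (v : 'I_q -> V).
Hypothesis vE : forall m, mul (un (s m)) (v m) = v m.

Let y l := em (e l).
Let y' k l := em (t (un (ix k)) *: mul (b k) (b l)).
Let v' m := em (v m).

Lemma extract_value k z : z \in S -> z \in gr (g k) ->
  extract y y' k (em z) = t (mul z (b k)) *: em (un (ix k)).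
Proof.
move=> zS zg; rewrite -(embZ galgV) -(coordinate_extraction charF galgV WM hb unP bA bg tb zS zg).
by rewrite (emb_sum galgV); apply: eq_bigr => l _; rewrite !(embM galgV).
Qed.

(** Every extraction leaves a scalar times the unit of component [s m], and [v m], to its right,
    absorbs that unit. *)
Lemma word_value N (z : 'I_N -> 'I_d -> V) :
  (forall i k, z i k \in S /\ z i k \in gr (g k)) ->
  word ix s y y' v' (fun i k => em (z i k)) =
  (\prod_(m < q) \prod_(i < N) \prod_(k < d | ix k == s m) t (mul (z i k) (b k)))
    *: \prod_(m < q) em (v m).
Proof.
move=> zP; rewrite -prodr_scale; apply: eq_bigr => m _.
apply: prodr_scale_absorb => i _; apply: prodr_scale_absorb => k /eqP km.
have [zS zg] := zP i k.
by rewrite extract_value // -scalerAl km /v' -(embM galgV) vE.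
Qed.

(** On the basis [e], a permutation [p] moving some [k] contributes 0, because the word reads the
    coordinate of [e (p k)] at [e k]; only the identity remains. *)
Lemma alt_word_value N (l : seq 'I_N) (zeta : 'I_N -> 'I_d -> V) : uniq l ->
  (forall i k, zeta i k \in S /\ zeta i k \in gr (g k)) ->
  (forall i, i \in l -> zeta i = e) ->
  alts g l (word ix s y y' v') (fun i k => em (zeta i k)) =
  word ix s y y' v' (fun i k => em (zeta i k)).
Proof.
elim: l zeta => //= i l IH zeta /andP[il ul] zP ze.
have ei : zeta i = e by apply: ze; rewrite mem_head.
have updE p : (fun i0 k => em (upd zeta i (fun k => e (p k)) i0 k)) =
    upd (fun i k => em (zeta i k)) i (fun k => em (zeta i (p k))).
  apply: functional_extensionality => i0; rewrite /upd; case: eqP => // _.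
  by rewrite ei.
have zP' (p : 'I_d -> 'I_d) : (forall k, g (p k) = g k) ->
    forall i0 k, upd zeta i (fun k => e (p k)) i0 k \in S /\
               upd zeta i (fun k => e (p k)) i0 k \in gr (g k).
  move=> pg i0 k; rewrite /upd; case: eqP => // _.
  by rewrite -(pg k) (hb_mem hb) (hb_gr hb).
have val p : (forall k, g (p k) = g k) ->
    alts g l (word ix s y y' v') (upd (fun i k => em (zeta i k)) i (fun k => em (zeta i (p k))))
    = word ix s y y' v' (upd (fun i k => em (zeta i k)) i (fun k => em (zeta i (p k)))).
  move=> pg; rewrite -updE IH //; first exact: zP'.
  move=> i0 i0l; rewrite /upd; case: eqP => [i0i|_]; first by rewrite i0i (negPf il) in i0l.
  by apply: ze; rewrite inE i0l orbT.
rewrite /alt_block /altsum (bigD1 1%g) /=; last first.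
  by apply/forallP=> k; rewrite pvalE perm1.
rewrite odd_perm1 scale1r val => [|k]; last by rewrite perm1.
rewrite big1 ?addr0 => [|p /andP[pp p1]].
  congr (word _ _ _ _ _ _); apply: functional_extensionality => i0.
  apply: functional_extensionality => k; rewrite /upd; case: eqP => // ->.
  by rewrite perm1.
have pg k : g (p k) = g k by have /eqP := forallP pp k; rewrite pvalE.
rewrite val // -updE word_value; last exact: zP'.
have [k pk] : exists k, p k != k.
  apply/existsP; apply: contraNT p1; rewrite negb_exists => /forallP H.
  by apply/eqP/permP=> k; rewrite perm1; apply/eqP; have := H k; rewrite negbK.
rewrite (bigD1 ((s^-1)%g (ix k))) //= (bigD1 i) //= (bigD1 k) ?permKV //=.
by rewrite upd_eq tb (negPf pk) !mul0r scale0r scaler0.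
Qed.

Lemma word_at_basis N : word ix s y y' v' (fun (i : 'I_N) k => em (e k)) =
  \prod_(m < q) em (v m).
Proof.
rewrite (word_value (z := fun _ => e)) => [|i k]; last by rewrite (hb_mem hb) (hb_gr hb).
rewrite big1 ?scale1r // => m _; rewrite big1 // => i _; rewrite big1 // => k _.
by rewrite tb eqxx.
Qed.

Lemma fullpoly_value N r (ms : seq (seq 'I_r)) (x' : 'I_r -> V) tm :
  (forall w, w \in ms -> w != [::]) -> GRing.rterm tm ->
  (forall w, w \in ms -> wprod mul x' w \in S /\ wprod mul x' w \in gr 1%g) ->
  fullpoly g ix s ms tm (fun l : label N d r q => em (label_case (fun _ k => e k)
     (fun _ j => x' j) e (fun k l => t (un (ix k)) *: mul (b k) (b l)) v l)) =
  GRing.eval (trace_env ms mul e x') tm ^+ N *: \prod_(m < q) em (v m).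
Proof.
move=> ms0 rt wS; rewrite /fullpoly.
have Smul : mul_closed mul S := S_mul galgV WM.
rewrite (ops_value galgV hb Smul ms0 rt (x' := x')) ?enum_uniq //; first last.
- by move=> i; exact: ss_block_e hb.
- by move=> i _; apply: alt_word_det.
rewrite size_enum_ord; congr (_ *: _); rewrite -(@word_at_basis N).
apply: (alt_word_value (zeta := fun _ => e)) => //; first exact: enum_uniq.
by move=> i k; rewrite (hb_mem hb) (hb_gr hb).
Qed.

End FullAlgebra.

(** * Transfer of trace identities *)

Section WordProducts.
Variables (F : fieldType) (gT : finGroupType) (V : vectType F).
Variables (mul : V -> V -> V) (gr : gT -> {vspace V}).
Hypothesis galgV : galg mul gr.
Variables (r : nat) (ga : 'I_r -> gT).

Definition wdeg (w : seq 'I_r) := (\prod_(j <- w) ga j)%g.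

Lemma wprod_mem (S : {vspace V}) (x : 'I_r -> V) w : mul_closed mul S -> w != [::] ->
  (forall j, x j \in S) -> (forall j, x j \in gr (ga j)) ->
  wprod mul x w \in S /\ wprod mul x w \in gr (wdeg w).
Proof.
move=> Smul; case: w => // a w _ xS xg /=; rewrite /wdeg big_cons.
move: (xS a) (xg a); move: (x a) (ga a) => y h yS yh.
elim: w y h yS yh => [|j w IH] y h yS yh /=; first by rewrite big_nil mulg1.
rewrite big_cons mulgA; apply: IH; first by rewrite Smul.
exact: (mul_gr galgV).
Qed.

End WordProducts.

Section Transfer.
Variables (F : closedFieldType) (gT : finGroupType) (V W : vectType F).
Hypothesis charF : [pchar F] =i pred0.
Variables (mulV : V -> V -> V) (grV : gT -> {vspace V}).
Variables (mulW : W -> W -> W) (grW : gT -> {vspace W}).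
Hypotheses (gV : galg mulV grV) (gW : galg mulW grW).
Variables (JA : {vspace V}) (JB : {vspace W}) (qA qB : nat).
Variables (Ai : 'I_qA -> {vspace V}) (Bi : 'I_qB -> {vspace W}).
Hypotheses (WMA : graded_WM mulV grV JA Ai) (WMB : graded_WM mulW grW JB Bi).
Hypothesis fullB : full mulW JB Bi.
Hypothesis idVW : forall p : gpoly F gT, is_gid mulV grV p -> is_gid mulW grW p.
Let SA := (\sum_(i < qA) Ai i)%VS.
Let SB := (\sum_(i < qB) Bi i)%VS.

(** All values are split homogeneously modulo the radical. For a proper subset [theta], some group
    is evaluated at its semisimple parts, where [Phi] vanishes by assumption. *)
Lemma vanish_of_ss N d r q (deg : label N d r q -> gT)
    (Phi : forall R : algType F, (label N d r q -> R) -> R) :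
  (0 < N)%N -> (forall x, x \in Jpow mulV JA N -> x = 0) -> definable Phi ->
  (forall sv i, (forall l, sv l \in grV (deg l)) ->
     (forall k, sv (lz _ _ i k) \in SA) -> (forall j, sv (lx _ _ i j) \in SA) ->
     Phi _ (emb mulV \o sv) = 0) ->
  forall sv, (forall l, sv l \in grV (deg l)) -> Phi _ (emb mulV \o sv) = 0.
Proof.
move=> N0 JN dPhi H sv svg.
have Jid : ideal_in mulV fullv JA by case: WMA => -[].
have [s0 s0P] := fin_all_exists (fun l => SJ_split_gr charF gV WMA (svg l)).
apply: (definable_vanish gV Jid deg (grp := @label_group N d r q) (s0 := s0) N0 JN dPhi).
  by move=> l _; case: (s0P l).
move=> theta thT; have [i ith] : exists i, i \notin theta.
  apply/existsP; apply: contraNT thT; rewrite negb_exists => /forallP thT.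
  by apply/eqP/setP=> i; rewrite inE; have := thT i; rewrite negbK => ->.
apply: (H _ i) => [l|k|j].
- by case: (s0P l) => _ sg _; case: label_group => [i'|] //; case: ifP.
- by rewrite /= (negPf ith); case: (s0P (lz _ _ i k)).
by rewrite /= (negPf ith); case: (s0P (lx _ _ i j)).
Qed.

Variables (d : nat) (g : 'I_d -> gT) (eB : 'I_d -> W) (ix : 'I_d -> 'I_qB).
Hypotheses (hbB : hbasis grW SB g eB) (eix : forall k, eB k \in Bi (ix k)).

Section Terms.
Variables (r : nat) (ga : 'I_r -> gT) (ms : seq (seq 'I_r)) (tm : GRing.term F).
Hypotheses (ms0 : forall w, w \in ms -> w != [::]) (rt : GRing.rterm tm).
Hypothesis msdeg : forall w, w \in ms -> wdeg ga w = 1%g.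

(** By [vanish_of_ss] the polynomial vanishes on [A], hence on [B]. There its value at the basis of
    [SB] is the [N]-th power of the wanted scalar times a product that fullness of [B] makes
    nonzero. *)
Lemma full_transfer :
  (forall N (s : {perm 'I_qB}) (sv : label N d r qB -> V) i,
     (forall k, sv (lz _ _ i k) \in SA /\ sv (lz _ _ i k) \in grV (g k)) ->
     (forall j, sv (lx _ _ i j) \in SA /\ sv (lx _ _ i j) \in grV (ga j)) ->
     fullpoly g ix s ms tm (emb mulV \o sv) = 0) ->
  forall x' : 'I_r -> W, (forall j, x' j \in SB /\ x' j \in grW (ga j)) ->
  GRing.eval (trace_env ms mulW eB x') tm = 0.
Proof.
move=> HA x' x'P.
have [un unP] := Ai_unit charF gW WMB hbB.
have [b [bA bg tb]] := dual_basis charF gW WMB hbB eix.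
have [s [hv [v [q0 vg vE vnz]]]] := full_homogeneous gW unP fullB.
have [n nJ] : nilpotent_sub mulV JA by case: WMA => -[].
(* [nprod] at index [n] has [n + 1] factors, so the power [n + 1] of the radical is 0. *)
pose N := n.+1.
pose deg : label N d r qB -> gT := label_case (fun _ k => g k) (fun _ j => ga j) g
  (fun k l => ((g k)^-1 * (g l)^-1)%g) hv.
pose sv : label N d r qB -> W := label_case (fun _ k => eB k) (fun _ j => x' j) eB
  (fun k l => tr mulW eB (un (ix k)) *: mulW (b k) (b l)) v.
have svg l : sv l \in grW (deg l).
  case: l => [[[[[i k]|[i j]]|l]|[k l]]|m] /=.
  - exact: (hb_gr hbB).
  - exact: (x'P j).2.
  - exact: (hb_gr hbB).
  - by rewrite memvZ // (mul_gr gW).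
  exact: vg.
have wS w : w \in ms -> wprod mulW x' w \in SB /\ wprod mulW x' w \in grW 1%g.
  move=> wm; rewrite -(msdeg wm); apply: (wprod_mem gW) => //.
  - exact: (S_mul gW WMB).
  - exact: ms0.
  - by move=> j; case: (x'P j).
  by move=> j; case: (x'P j).
have := fullpoly_value charF gW WMB hbB unP bA bg tb vE N ms0 rt wS.
have dF := @definable_fullpoly F gT N d r qB g ix s ms tm.
have VA sv0 : (forall l, sv0 l \in grV (deg l)) ->
    fullpoly g ix s ms tm (emb mulV \o sv0) = 0.
  move: sv0; apply: (vanish_of_ss (deg := deg)) => // [x|sv0 i sg zS xS].
    exact: (Jpow_nilpotent gV nJ).
  by apply: (HA _ _ _ i) => [k|j]; split.
have := definable_transfer gV gW idVW dF VA svg.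
rewrite (_ : emb mulW \o sv = fun l => emb mulW (sv l)) // => ->.
move/esym/eqP; rewrite scaler_eq0 (negPf vnz) orbF expf_eq0 /=.
by move/eqP.
Qed.

End Terms.

(** The bases of [SA] and [SB] share the degrees [g], so the operators of the polynomial built from
    [B] act on semisimple blocks of [A] through the traces of [A]. *)
Lemma trace_transfer (eA : 'I_d -> V) r (ga : 'I_r -> gT) ms (tm : GRing.term F) :
  hbasis grV SA g eA -> (forall w, w \in ms -> w != [::]) -> GRing.rterm tm ->
  (forall w, w \in ms -> wdeg ga w = 1%g) ->
  (forall x : 'I_r -> V, (forall j, x j \in SA /\ x j \in grV (ga j)) ->
     GRing.eval (trace_env ms mulV eA x) tm = 0) ->
  forall x : 'I_r -> W, (forall j, x j \in SB /\ x j \in grW (ga j)) ->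
     GRing.eval (trace_env ms mulW eB x) tm = 0.
Proof.
move=> hbA ms0 rt msdeg HA; apply: (full_transfer ms0 rt msdeg) => N s sv i zP xP.
have Smul : mul_closed mulV SA := S_mul gV WMA.
apply: (ops_vanish gV hbA Smul ms0 rt (i := i) (x' := fun j => sv (lx _ _ i j))).
- by [].
- move=> w wm; rewrite -(msdeg w wm); apply: (wprod_mem gV) => //; first exact: ms0.
    by move=> j; case: (xP j).
  by move=> j; case: (xP j).
- exact: HA.
- by rewrite mem_enum.
- exact: enum_uniq.
- exact: alt_word_det.
by exists (fun k => sv (lz _ _ i k)) => k; case: (zP k).
Qed.

(** Otherwise the variables of degree [h] in a block of the polynomial of [B] take dependent values
    in [SA], the alternating polynomial vanishes, and [full_transfer] for the constant term 1 yields
    [1 = 0]. *)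
Lemma degree_count_le dA (gA : 'I_dA -> gT) (eA : 'I_dA -> V) h : hbasis grV SA gA eA ->
  (#|[pred k | g k == h]| <= #|[pred k | gA k == h]|)%N.
Proof.
move=> hbA; rewrite leqNgt; apply/negP => lt.
have H : GRing.eval (trace_env [::] mulW eB (fun j : 'I_0 => 0)) (GRing.Const 1) = 0.
  apply: (@full_transfer 0 (fun=> 1%g)) => //; last by case.
  move=> N s sv i zP _; rewrite fullpoly_const1.
  set K := [pred k | g k == h] in lt *; set L := [pred k | gA k == h] in lt *.
  pose z k := sv (lz _ _ i k).
  (* Coordinates of the values of degree [h] in the basis of [SA]. There are more rows than columns,
     so the left kernel is nonzero; [a] extends a kernel vector by 0 to all of the block. *)
  pose M := \matrix_(j < #|K|, l < #|L|) cf eA (enum_val l) (z (enum_val j)).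
  have : kermx M != 0.
    rewrite kermx_eq0; apply: contraTN lt => /eqP <-.
    by rewrite -leqNgt rank_leq_col.
  case/rowV0Pn => u /sub_kermxP uM u0.
  pose a := \row_k \sum_(j < #|K|) u 0 j * (enum_val j == k)%:R.
  rewrite -(upd_id (fun i k => (emb mulV \o sv) (lz _ _ i k)) i).
  apply: (block_det_dependent (g := g) _ _ (h := h) (a := a)); first exact: alt_word_det.
  - move=> k kh; rewrite mxE big1 // => j _; case: eqP => [jk|]; last by rewrite mulr0.
    by have := enum_valP j; rewrite inE jk (negPf kh).
  - apply: contraNneq u0 => a0; apply/eqP/rowP=> j.
    have := congr1 (fun w : 'rV_d => w 0 (enum_val j)) a0; rewrite !mxE => <-.
    rewrite (bigD1 j) //= eqxx mulr1 big1 ?addr0 // => j' j'j.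
    by rewrite (inj_eq enum_val_inj) (negPf j'j) mulr0.
  have -> : \sum_k a 0 k *: emb mulV (z k) = emb mulV (\sum_(j < #|K|) u 0 j *: z (enum_val j)).
    rewrite (emb_sum gV).
    under eq_bigr do rewrite mxE scaler_suml.
    rewrite exchange_big; apply: eq_bigr => j _.
    rewrite (embZ gV) (bigD1 (enum_val j)) //= eqxx mulr1 big1 ?addr0 // => k.
    by rewrite eq_sym => /negPf ->; rewrite mulr0 scale0r.
  rewrite (_ : \sum_(j < _) _ = 0) ?(emb0 gV) //.
  have zS : \sum_(j < #|K|) u 0 j *: z (enum_val j) \in SA.
    by apply: memv_suml => j _; rewrite memvZ //; case: (zP (enum_val j)).
  rewrite (hb_expand hbA zS) big1 // => l _; rewrite cf_sum.
  have [lh|lh] := eqVneq (gA l) h.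
    have lL : l \in L by rewrite inE lh.
    have /rowP/(_ (enum_rank_in lL l)) := uM; rewrite !mxE => E.
    rewrite [X in X *: _](_ : _ = 0) ?scale0r // -[RHS]E; apply: eq_bigr => j _.
    by rewrite mxE enum_rankK_in.
  rewrite big1 ?scale0r // => j _; have [zj zg] := zP (enum_val j).
  rewrite (hb_supp gV hbA zj zg) ?mulr0 //.
  by have := enum_valP j; rewrite inE => /eqP ->.
by move/eqP: H; rewrite /= oner_eq0.
Qed.

End Transfer.

(** * Quantifier elimination and generic points *)

Section QuantifierElimination.
Variable F : closedFieldType.

Lemma closed_field_qe (f : GRing.formula F) : GRing.rformula f ->
  exists psi : GRing.formula F, [/\ GRing.qf_form psi, GRing.rformula psi &
    forall e, GRing.holds e f <-> GRing.qf_eval e psi].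
Proof.
move=> rf; have Fc : GRing.closed_field_axiom F := @solve_monicpoly F.
exists (GRing.quantifier_elim (@ClosedFieldQE.ex_elim F) f).
have /andP[qf rqf] := GRing.quantifier_elim_wf (@ClosedFieldQE.wf_ex_elim F) rf.
split=> // e; apply: (rwP (GRing.quantifier_elim_rformP _ _ _ rf)).
- exact: ClosedFieldQE.wf_ex_elim.
- exact: ClosedFieldQE.holds_ex_elim.
Qed.

(** [h] defines a principal open set, nonempty on [X], on which the formula has one truth value, the
    same for [X] and [Y]. *)
Definition generically_constant (X Y : Type) (EX : X -> seq F) (EY : Y -> seq F)
    (f : GRing.formula F) :=
  exists h, [/\ GRing.rterm h, exists x, GRing.eval (EX x) h != 0 & exists tv : bool,
    (forall x, GRing.eval (EX x) h != 0 -> GRing.qf_eval (EX x) f = tv) /\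
    (forall y, GRing.eval (EY y) h != 0 -> GRing.qf_eval (EY y) f = tv)].

(** For an equation, the difference of both sides either vanishes on all of [X], hence on [Y], or
    serves itself as [h]. Connectives multiply the two [h], and irreducibility keeps the product
    nonzero somewhere. *)
Lemma generic_truth (X Y : Type) (EX : X -> seq F) (EY : Y -> seq F) :
  X ->
  (forall h1 h2, GRing.rterm h1 -> GRing.rterm h2 ->
     (exists x, GRing.eval (EX x) h1 != 0) -> (exists x, GRing.eval (EX x) h2 != 0) ->
     exists x, GRing.eval (EX x) h1 != 0 /\ GRing.eval (EX x) h2 != 0) ->
  (forall h, GRing.rterm h -> (exists y, GRing.eval (EY y) h != 0) ->
     exists x, GRing.eval (EX x) h != 0) ->
  forall psi, GRing.qf_form psi -> GRing.rformula psi -> generically_constant EX EY psi.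
Proof.
move=> x0 irr YX.
have bin (op : bool -> bool -> bool) f1 f2 f :
  (forall e, GRing.qf_eval e f = op (GRing.qf_eval e f1) (GRing.qf_eval e f2)) ->
  generically_constant EX EY f1 -> generically_constant EX EY f2 ->
  generically_constant EX EY f.
  move=> fE [h1 [r1 nz1 [b1 [X1 Y1]]]] [h2 [r2 nz2 [b2 [X2 Y2]]]].
  exists (GRing.Mul h1 h2); split=> /=; first by rewrite r1.
    by have [x [? ?]] := irr _ _ r1 r2 nz1 nz2; exists x; rewrite mulf_neq0.
  exists (op b1 b2); split=> z; rewrite mulf_eq0 negb_or => /andP[? ?].
    by rewrite fE X1 ?X2.
  by rewrite fE Y1 ?Y2.
have one b f : (forall x, GRing.qf_eval (EX x) f = b) -> (forall y, GRing.qf_eval (EY y) f = b) ->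
    generically_constant EX EY f.
  move=> fX fY; exists (GRing.Const 1); split=> //=; first by exists x0; rewrite oner_eq0.
  by exists b.
elim=> //= [b|t1 t2|f1 IH1 f2 IH2|f1 IH1 f2 IH2|f1 IH1 f2 IH2|f1 IH1].
- by move=> _ _; apply: (one b).
- move=> _ /andP[r1 r2]; pose h := GRing.Add t1 (GRing.Opp t2).
  have rh : GRing.rterm h by rewrite /= r1.
  have [nz|z] := classic (exists x, GRing.eval (EX x) h != 0).
    by exists h; split=> //; exists false; split=> z; rewrite /= subr_eq0 => /negPf.
  apply: (one true) => [x|y] /=; rewrite -subr_eq0; apply/eqP; apply: NNPP => /eqP nz.
    by apply: z; exists x.
  by apply: z; apply: (YX h rh); exists y.
- by move=> /andP[q1 q2] /andP[r1 r2]; apply: (bin andb f1 f2); auto.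
- by move=> /andP[q1 q2] /andP[r1 r2]; apply: (bin orb f1 f2); auto.
- by move=> /andP[q1 q2] /andP[r1 r2]; apply: (bin implb f1 f2); auto.
by move=> q1 r1; apply: (bin (fun b _ => ~~ b) f1 f1); auto.
Qed.

Fixpoint exists_many (s : seq nat) (f : GRing.formula F) :=
  if s is i :: s' then GRing.Exists i (exists_many s' f) else f.

Lemma rformula_exists_many s f : GRing.rformula f -> GRing.rformula (exists_many s f).
Proof. by elim: s. Qed.

Lemma holds_exists_many_intro f (c e : seq F) :
  GRing.holds (e ++ c) f -> GRing.holds e (exists_many (iota (size e) (size c)) f).
Proof.
elim: c e => [|a c IH] e /=; first by rewrite cats0.
move=> H; exists a; have -> : set_nth 0 e (size e) a = rcons e a.
  by elim: e {H IH} => //= b e ->.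
by rewrite -(size_rcons e a); apply: IH; rewrite cat_rcons.
Qed.

Lemma holds_exists_many_elim f s (e : seq F) : GRing.holds e (exists_many s f) ->
  exists e', (forall i, i \notin s -> e'`_i = e`_i) /\ GRing.holds e' f.
Proof.
elim: s e => [|i s IH] e /=; first by exists e.
case=> a /IH[e' [E H]]; exists e'; split=> // j.
rewrite inE negb_or => /andP[ji js]; rewrite E // nth_set_nth /=.
by rewrite (negPf ji).
Qed.

Definition tsum (I : Type) (s : seq I) (f : I -> GRing.term F) :=
  foldr (fun i u => GRing.Add (f i) u) (GRing.Const 0) s.

Lemma eval_tsum (I : Type) (s : seq I) f e :
  GRing.eval e (tsum s f) = \sum_(i <- s) GRing.eval e (f i).
Proof. by elim: s => [|i s IH]; rewrite ?big_nil // big_cons /= IH. Qed.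

Lemma rterm_tsum (I : Type) (s : seq I) f :
  (forall i, GRing.rterm (f i)) -> GRing.rterm (tsum s f).
Proof. by move=> rf; elim: s => //= i s ->; rewrite rf. Qed.

Fixpoint conj_many (s : seq (GRing.formula F)) :=
  if s is f :: s' then GRing.And f (conj_many s') else GRing.Bool true.

Lemma rformula_conj_many (I : Type) (s : seq I) f :
  (forall i, GRing.rformula (f i)) -> GRing.rformula (conj_many [seq f i | i <- s]).
Proof. by move=> rf; elim: s => //= i s ->; rewrite rf. Qed.

Lemma holds_conj_many (I : eqType) (s : seq I) f e :
  GRing.holds e (conj_many [seq f i | i <- s]) <-> forall i, i \in s -> GRing.holds e (f i).
Proof.
elim: s => //= i s IH; split=> [[Hi /IH Hs] j|H].
  by rewrite inE => /predU1P[->|/Hs].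
split; first by apply: H; rewrite mem_head.
by apply/IH => j js; apply: H; rewrite inE js orbT.
Qed.

(** A substitute for polynomial functions on a vector space which only involves polynomials in one
    variable. *)
Definition poly_on_lines (V : lmodType F) (I : Type) (phi : (I -> V) -> F) :=
  forall x x' : I -> V, exists p : {poly F},
    forall a, phi (fun j => x j + a *: (x' j - x j)) = p.[a].

(** Irreducibility of a linear space: on the line through the two given points both functions are
    nonzero polynomials, and their product has a non-root. *)
Lemma nonvanishing_both (V : vectType F) (I : Type) (M : I -> {vspace V}) (phi psi : (I -> V) -> F) :
  poly_on_lines phi -> poly_on_lines psi ->
  (exists2 x, (forall j, x j \in M j) & phi x != 0) ->
  (exists2 x, (forall j, x j \in M j) & psi x != 0) ->
  exists2 x, (forall j, x j \in M j) & phi x != 0 /\ psi x != 0.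
Proof.
move=> lp lq [x xM px] [x' xM' px'].
have [p pE] := lp x x'; have [u uE] := lq x x'.
have E0 : (fun j => x j + 0 *: (x' j - x j)) = x.
  by apply: functional_extensionality => j; rewrite scale0r addr0.
have E1 : (fun j => x j + 1 *: (x' j - x j)) = x'.
  by apply: functional_extensionality => j; rewrite scale1r addrC subrK.
have p0 : p != 0 by apply: contra px => /eqP p0; rewrite -E0 pE p0 horner0.
have u0 : u != 0 by apply: contra px' => /eqP u0; rewrite -E1 uE u0 horner0.
have /closed_nonrootP[a] : p * u != 0 by rewrite mulf_neq0.
rewrite rootE hornerM mulf_eq0 negb_or => /andP[pa ua].
exists (fun j => x j + a *: (x' j - x j)); last by rewrite pE uE.
by move=> j; rewrite memvD // memvZ // memvB.
Qed.

Lemma poly_on_lines_const (V : lmodType F) (I : Type) c :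
  poly_on_lines (fun _ : I -> V => c).
Proof. by move=> x x'; exists c%:P => a; rewrite hornerC. Qed.

Lemma poly_on_lines_eval (V : lmodType F) (I : Type) (E : (I -> V) -> seq F) h :
  (forall n, poly_on_lines (fun x => (E x)`_n)) -> GRing.rterm h ->
  poly_on_lines (fun x => GRing.eval (E x) h).
Proof.
move=> pE; elim: h => //= [c _|n _|a IHa b IHb|a IHa|a IHa n|a IHa b IHb|a IHa n].
- exact: poly_on_lines_const.
- exact: poly_on_lines_const.
- case/andP=> /IHa Ha /IHb Hb x x'; have [p pa] := Ha x x'; have [u ub] := Hb x x'.
  by exists (p + u) => l; rewrite pa ub hornerD.
- by move=> /IHa Ha x x'; have [p pa] := Ha x x'; exists (- p) => l; rewrite pa hornerN.
- by move=> /IHa Ha x x'; have [p pa] := Ha x x'; exists (p *+ n) => l; rewrite pa hornerMn.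
- case/andP=> /IHa Ha /IHb Hb x x'; have [p pa] := Ha x x'; have [u ub] := Hb x x'.
  by exists (p * u) => l; rewrite pa ub hornerM.
by move=> /IHa Ha x x'; have [p pa] := Ha x x'; exists (p ^+ n) => l; rewrite pa horner_exp.
Qed.

Lemma poly_on_lines_det (V : lmodType F) (I : Type) d (G : (I -> V) -> 'M[F]_d) :
  (forall i j, poly_on_lines (fun x => G x i j)) -> poly_on_lines (fun x => \det (G x)).
Proof.
move=> pG x x'.
have ex i := fin_all_exists (fun j => pG i j x x').
have [P PE] := fin_all_exists ex.
exists (\det (\matrix_(i, j) P i j)) => a.
rewrite -horner_evalE -det_map_mx; congr (\det _); apply/matrixP=> i j.
by rewrite !mxE /horner_eval PE.
Qed.

End QuantifierElimination.

(** * Traces of words, as polynomial functions and as first-order terms *)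

Section TracePolynomials.
Variables (F : closedFieldType) (gT : finGroupType) (V : vectType F).
Variables (mul : V -> V -> V) (gr : gT -> {vspace V}).
Hypothesis galgV : galg mul gr.
Variables (d r : nat) (e : 'I_d -> V).

Definition curve (f : F -> V) :=
  exists L : seq ({poly F} * V), forall a, f a = \sum_(c <- L) c.1.[a] *: c.2.

Lemma curve_mul f f' : curve f -> curve f' -> curve (fun a => mul (f a) (f' a)).
Proof.
move=> [L LE] [L' LE']; exists [seq (c.1 * c'.1, mul c.2 c'.2) | c <- L, c' <- L'] => a.
rewrite LE LE' (mulv_suml galgV) big_allpairs_dep; apply: eq_bigr => c _.
rewrite (mulv_sumr galgV); apply: eq_bigr => c' _.
by rewrite (mulvZl galgV) (mulvZr galgV) scalerA hornerM.
Qed.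

Lemma curve_wprod (x x' : 'I_r -> V) w :
  curve (fun a => wprod mul (fun j => x j + a *: (x' j - x j)) w).
Proof.
have lc j : curve (fun a => x j + a *: (x' j - x j)).
  exists [:: (1, x j); ('X, x' j - x j)] => a.
  by rewrite big_cons big_seq1 /= hornerC hornerX scale1r.
case: w => [|i w]; first by exists [::] => a; rewrite big_nil.
elim/last_ind: w => [|w j IH] //=.
have [L LE] := curve_mul IH (lc j).
by exists L => a; rewrite -LE /= foldl_rcons.
Qed.

Lemma poly_on_lines_trace (w : seq 'I_r) : poly_on_lines (fun x => tr mul e (wprod mul x w)).
Proof.
move=> x x'; have [L LE] := curve_wprod x x' w.
exists (\sum_(c <- L) c.1 * (tr mul e c.2)%:P) => a.
rewrite LE (tr_sum galgV) horner_sum; apply: eq_bigr => c _.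
by rewrite (trZ galgV) hornerM hornerC.
Qed.

Lemma poly_on_lines_trace_env ms n :
  poly_on_lines (fun x : 'I_r -> V => (trace_env ms mul e x)`_n).
Proof.
have [nm|nm] := ltnP n (size ms); last first.
  move=> x x'; exists 0 => a; rewrite horner0 nth_default //.
  by rewrite size_map.
move=> x x'; have [p pE] := poly_on_lines_trace (nth [::] ms n) x x'.
by exists p => a; rewrite -pE (nth_map [::]).
Qed.

Variable S : {vspace V}.
Variable g : 'I_d -> gT.
Hypotheses (hb : hbasis gr S g e) (Smul : mul_closed mul S).

(* The coordinates, as terms, of the product of an element with coordinates u by the
   word w in the elements with coordinates X j. *)
Fixpoint wcoord (X : 'I_r -> 'I_d -> GRing.term F) (u : 'I_d -> GRing.term F) (w : seq 'I_r) :=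
  if w is j :: w' then
    wcoord X (fun m => tsum (enum 'I_d) (fun k => tsum (enum 'I_d) (fun l =>
      GRing.Mul (GRing.Mul (u k) (X j l)) (GRing.Const (cf e m (mul (e k) (e l))))))) w'
  else u.

Definition wtrace X (w : seq 'I_r) : GRing.term F :=
  if w is j :: w' then tsum (enum 'I_d) (fun m =>
    GRing.Mul (wcoord X (X j) w' m) (GRing.Const (tr mul e (e m))))
  else GRing.Const 0.

Lemma rterm_wtrace X w : (forall j k, GRing.rterm (X j k)) -> GRing.rterm (wtrace X w).
Proof.
move=> rX; case: w => //= j w; apply: rterm_tsum => m /=; rewrite andbT.
elim: w (X j) (rX j) m => //= i w IH u ru m; apply: IH => {}m.
by apply: rterm_tsum => k; apply: rterm_tsum => l; rewrite /= ru rX.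
Qed.

Lemma eval_wtrace X w env (x : 'I_r -> V) :
  (forall j, x j = \sum_k GRing.eval env (X j k) *: e k) ->
  GRing.eval env (wtrace X w) = tr mul e (wprod mul x w).
Proof.
move=> xE; case: w => [|j w] /=; first by rewrite (tr0 galgV).
rewrite eval_tsum big_enum /=.
suff -> : foldl (fun y i => mul y (x i)) (x j) w =
    \sum_m GRing.eval env (wcoord X (X j) w m) *: e m.
  by rewrite (tr_sum galgV); apply: eq_bigr => m _; rewrite (trZ galgV).
elim: w (x j) (X j) (xE j) => //= i w IH y u yE; apply: IH.
rewrite yE xE (mulv_suml galgV).
transitivity (\sum_k \sum_l \sum_m (GRing.eval env (u k) * GRing.eval env (X i l) *
    cf e m (mul (e k) (e l))) *: e m).
  apply: eq_bigr => k _; rewrite (mulvZl galgV) (mulv_sumr galgV) scaler_sumr.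
  apply: eq_bigr => l _; rewrite (mulvZr galgV) scalerA.
  rewrite {1}(hb_expand hb (Smul (hb_mem hb k) (hb_mem hb l))) scaler_sumr.
  by apply: eq_bigr => m _; rewrite scalerA.
have sum3 (f : 'I_d -> 'I_d -> 'I_d -> V) :
    \sum_k \sum_l \sum_m f k l m = \sum_m \sum_k \sum_l f k l m.
  by rewrite [RHS]exchange_big; apply: eq_bigr => k _; rewrite exchange_big.
rewrite sum3; apply: eq_bigr => m _.
rewrite eval_tsum big_enum scaler_suml; apply: eq_bigr => k _.
by rewrite eval_tsum big_enum scaler_suml; apply: eq_bigr.
Qed.

End TracePolynomials.

(** * Recovering the semisimple part from its traces *)

Section Isomorphism.
Variables (F : closedFieldType) (gT : finGroupType) (V W : vectType F).
Hypothesis charF : [pchar F] =i pred0.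
Variables (mulV : V -> V -> V) (grV : gT -> {vspace V}).
Variables (mulW : W -> W -> W) (grW : gT -> {vspace W}).
Hypotheses (gV : galg mulV grV) (gW : galg mulW grW).
Variables (JA : {vspace V}) (JB : {vspace W}) (qA qB : nat).
Variables (Ai : 'I_qA -> {vspace V}) (Bi : 'I_qB -> {vspace W}).
Hypotheses (WMA : graded_WM mulV grV JA Ai) (WMB : graded_WM mulW grW JB Bi).
Let SA := (\sum_(i < qA) Ai i)%VS.
Let SB := (\sum_(i < qB) Bi i)%VS.
Variables (d : nat) (g : 'I_d -> gT) (eA : 'I_d -> V) (eB : 'I_d -> W).
Hypotheses (hbA : hbasis grV SA g eA) (hbB : hbasis grW SB g eB).

Let SAmul : mul_closed mulV SA := S_mul gV WMA.
Let SBmul : mul_closed mulW SB := S_mul gW WMB.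

Definition gram (U : vectType F) (mul : U -> U -> U) (e x : 'I_d -> U) : 'M[F]_d :=
  \matrix_(i, j) tr mul e (wprod mul x [:: i; j]).

(** Words of length 2 and 3, restricted to degree 1; on homogeneous elements the other degrees have
    trace 0 by [tr_deg]. *)
Definition trace_words : seq (seq 'I_d) :=
  [seq w <- [seq [:: i; j] | i <- enum 'I_d, j <- enum 'I_d] ++
     [seq i :: w | i <- enum 'I_d, w <- [seq [:: j; l] | j <- enum 'I_d, l <- enum 'I_d]]
   | wdeg g w == 1%g].

Lemma trace_words_neq0 w : w \in trace_words -> w != [::].
Proof.
rewrite mem_filter mem_cat => /andP[_ /orP[]].
  by case/allpairsP => p [_ _ ->].
by case/allpairsP => p [_ _ ->].
Qed.

Lemma trace_words_deg w : w \in trace_words -> wdeg g w = 1%g.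
Proof. by rewrite mem_filter => /andP[/eqP]. Qed.

Lemma trace_words2 i j : wdeg g [:: i; j] = 1%g -> [:: i; j] \in trace_words.
Proof.
move=> w1; rewrite mem_filter w1 eqxx mem_cat; apply/orP; left.
by apply: allpairs_f; rewrite mem_enum.
Qed.

Lemma trace_words3 i j l : wdeg g [:: i; j; l] = 1%g -> [:: i; j; l] \in trace_words.
Proof.
move=> w1; rewrite mem_filter w1 eqxx mem_cat; apply/orP; right.
apply/allpairsP; exists (i, [:: j; l]); rewrite mem_enum; split=> //.
by apply: allpairs_f; rewrite mem_enum.
Qed.

(** A linear relation among the [x j] would give a vector in the left kernel of the Gram matrix;
    independence and the dimension then give a basis. *)
Lemma gram_hbasis (U : vectType F) mul (gr : gT -> {vspace U}) (S : {vspace U}) (e x : 'I_d -> U) :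
  galg mul gr -> hbasis gr S g e -> (forall j, x j \in S /\ x j \in gr (g j)) ->
  \det (gram mul e x) != 0 -> hbasis gr S g x.
Proof.
move=> gU hb xP det0; split=> [j|]; first by case: (xP j).
have dimS : \dim S = d := size_basis hb.2.
rewrite basisEfree size_tuple dimS leqnn andbT; apply/andP; split.
  apply/freeP => k k0 j.
  have kG : (\row_i k i) *m gram mul e x = 0.
    apply/rowP=> l; rewrite !mxE.
    transitivity (tr mul e (mul (\sum_i k i *: x i) (x l))).
      rewrite (mulv_suml gU) (tr_sum gU); apply: eq_bigr => i _.
      by rewrite !mxE (mulvZl gU) (trZ gU).
    rewrite (_ : \sum_i k i *: x i = 0) ?(mul0v gU) ?(tr0 gU) //.
    rewrite -[RHS]k0; apply: eq_bigr => i _.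
    by rewrite (nth_map i) ?size_enum_ord // nth_ord_enum.
  have /rowP/(_ j) : (\row_i k i) = 0.
    by rewrite -(mulmxK (_ : gram mul e x \in unitmx) (\row_i k i)) ?kG ?mul0mx //
       unitmxE unitfE.
  by rewrite !mxE.
by apply/span_subvP => _ /mapP[j _ ->]; case: (xP j).
Qed.

Section FromTraces.
Variables (x : 'I_d -> V) (x' : 'I_d -> W).
Hypotheses (xP : forall j, x j \in SA /\ x j \in grV (g j)).
Hypotheses (xP' : forall j, x' j \in SB /\ x' j \in grW (g j)).
Hypothesis envE : trace_env trace_words mulV eA x = trace_env trace_words mulW eB x'.
Hypothesis gram0 : \det (gram mulV eA x) != 0.

Lemma trace_eq w : w != [::] -> (wdeg g w = 1%g -> w \in trace_words) ->
  tr mulV eA (wprod mulV x w) = tr mulW eB (wprod mulW x' w).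
Proof.
move=> w0 wm; have [w1|w1] := eqVneq (wdeg g w) 1%g.
  by move/eq_in_map: envE => /(_ w (wm w1)).
have [wS wg] := wprod_mem gV SAmul w0 (fun j => (xP j).1) (fun j => (xP j).2).
have [wS' wg'] := wprod_mem gW SBmul w0 (fun j => (xP' j).1) (fun j => (xP' j).2).
rewrite (tr_deg gV hbA _ wg w1) ?(tr_deg gW hbB _ wg' w1) //.
  by move=> y; apply: SBmul.
by move=> y; apply: SAmul.
Qed.

(** The map sends [x k] to [x' k]. The difference of [f (x_i x_j)] and [x'_i x'_j] is orthogonal to
    every [x'_l]: equal Gram matrices reduce the first trace to that of [x_i x_j x_l], and triple
    traces agree. *)
Lemma iso_of_traces : graded_iso mulV grV mulW grW SA SB.
Proof.
have gramE : gram mulV eA x = gram mulW eB x'.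
  apply/matrixP=> i j; rewrite !mxE; apply: trace_eq => //; exact: trace_words2.
have hx := gram_hbasis gV hbA xP gram0.
have hx' : hbasis grW SB g x' by apply: (gram_hbasis gW hbB xP'); rewrite -gramE.
have [f fE] : exists f : 'Hom(V, W), forall v, f v = \sum_k cf x k v *: x' k.
  apply: linear_lfun => a y z; rewrite scaler_sumr -big_split; apply: eq_bigr => k _.
  by rewrite cfP scalerDl scalerA.
have fx k : f (x k) = x' k.
  rewrite fE (bigD1 k) //= (hb_cf_e hx) eqxx scale1r big1 ?addr0 // => l lk.
  by rewrite (hb_cf_e hx) (negPf lk) scale0r.
have fS v : f v \in SB.
  by rewrite fE; apply: memv_suml => k _; rewrite memvZ //; case: (xP' k).
have fmulx i j : f (mulV (x i) (x j)) = mulW (x' i) (x' j).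
  have xxS : mulV (x i) (x j) \in SA by apply: SAmul; [case: (xP i) | case: (xP j)].
  have xxS' : mulW (x' i) (x' j) \in SB by apply: SBmul; [case: (xP' i) | case: (xP' j)].
  apply/eqP; rewrite -subr_eq0; apply/eqP.
  apply: (trace_form_nondeg charF gW WMB hbB (subvv _) SBmul) => [|z zS].
    by rewrite memvB.
  rewrite (hb_expand hx' zS) (mulv_sumr gW) (tr_sum gW) big1 // => l _.
  rewrite (mulvZr gW) (trZ gW) (mulvDl gW) (trD gW) (mulvNl gW) -scaleN1r (trZ gW) mulN1r.
  have := @trace_eq [:: i; j; l] isT (@trace_words3 i j l).
  rewrite /= => <-; rewrite fE (mulv_suml gW) (tr_sum gW).
  rewrite {2}(hb_expand hx xxS) (mulv_suml gV) (tr_sum gV).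
  rewrite (_ : \sum_(k < d) _ = \sum_k tr mulV eA (mulV (cf x k (mulV (x i) (x j)) *: x k) (x l))).
    by rewrite subrr mulr0.
  apply: eq_bigr => k _; rewrite (mulvZl gV) (mulvZl gW) (trZ gV) (trZ gW).
  by have /matrixP/(_ k l) := gramE; rewrite !mxE /= => ->.
exists f; split.
- apply/eqP; rewrite eqEsubv; apply/andP; split.
    by apply/subvP => _ /memv_imgP[v _ ->].
  apply/subvP => z zS; rewrite (hb_expand hx' zS); apply: memv_suml => k _.
  by rewrite memvZ // -fx memv_img //; case: (xP k).
- apply/eqP; rewrite -subv0; apply/subvP => v; rewrite memv_cap memv_ker => /andP[/eqP fv vS].
  rewrite memv0 (hb_expand hx vS) big1 // => k _.
  by rewrite -(hb_cf hx' (fun k => cf x k v)) -fE fv /cf linear0 scale0r.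
- move=> y z yS zS; rewrite {1}(hb_expand hx yS) {1}(hb_expand hx zS).
  rewrite (mulv_suml gV) linear_sum [f y]fE (mulv_suml gW); apply: eq_bigr => k _.
  rewrite (mulv_sumr gV) linear_sum [f z]fE (mulv_sumr gW); apply: eq_bigr => l _.
  rewrite (mulvZl gV) (mulvZr gV) (mulvZl gW) (mulvZr gW) !linearZ /=.
 by rewrite fmulx !scalerA mulrC.
move=> h v /memv_capP[vS vh]; rewrite fE; apply: memv_suml => k _.
have [<-|kh] := eqVneq (g k) h; first by rewrite memvZ //; case: (xP' k).
by rewrite (hb_supp gV hx vS vh kh) scale0r mem0v.
Qed.

End FromTraces.

(** The variables after those for the traces stand for the coordinates of an unknown tuple in [SB];
    coordinates of the wrong degree are set to 0, which makes the tuple homogeneous. *)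
Let env_term (j k : 'I_d) : GRing.term F :=
  if g k == g j then GRing.Var F (size trace_words + enum_rank (j, k)) else GRing.Const 0.

Let rterm_env_term (j k : 'I_d) : GRing.rterm (env_term j k).
Proof. by rewrite /env_term; case: ifP. Qed.

Definition trace_formula : GRing.formula F :=
  exists_many (iota (size trace_words) #|{: 'I_d * 'I_d}|)
    (conj_many [seq GRing.Equal (GRing.Var F n) (wtrace mulW eB env_term (nth [::] trace_words n))
               | n <- iota 0 (size trace_words)]).

Lemma rformula_trace_formula : GRing.rformula trace_formula.
Proof.
apply: rformula_exists_many; apply: rformula_conj_many => n /=.
by apply: rterm_wtrace; apply: rterm_env_term.
Qed.

Lemma trace_formulaP env : size env = size trace_words ->
  GRing.holds env trace_formula <->
  exists2 x' : 'I_d -> W, (forall j, x' j \in SB /\ x' j \in grW (g j)) &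
    env = trace_env trace_words mulW eB x'.
Proof.
move=> senv; split.
  case/holds_exists_many_elim => env' [envE /holds_conj_many H].
  pose x' j := \sum_k GRing.eval env' (env_term j k) *: eB k.
  exists x' => [j|].
    split; apply: memv_suml => k _; first by rewrite memvZ ?(hb_mem hbB).
    rewrite /env_term; case: eqP => [<-|_]; first by rewrite memvZ ?(hb_gr hbB).
    by rewrite scale0r mem0v.
  apply: (@eq_from_nth _ 0); first by rewrite senv size_map.
  move=> n; rewrite senv => nD; rewrite (nth_map [::]) //.
  rewrite -(eval_wtrace gW hbB SBmul (X := env_term) _ (env := env')) //.
  rewrite -(H n) /=; last by rewrite mem_iota.
  by rewrite envE // mem_iota leqNgt nD.
case=> x' xP' ->; set env0 := trace_env _ _ _ _.
have s0 : size env0 = size trace_words by rewrite size_map.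
pose c := [seq cf eB p.2 (x' p.1) | p <- enum {: 'I_d * 'I_d}].
have sc : size c = #|{: 'I_d * 'I_d}| by rewrite size_map -cardE.
rewrite /trace_formula -s0 -sc; apply: holds_exists_many_intro.
apply/holds_conj_many => n; rewrite mem_iota add0n => /andP[_ nD] /=.
rewrite (eval_wtrace gW hbB SBmul _ (x := x')) => [|j].
  by rewrite nth_cat nD (nth_map [::]) -?s0.
case: (xP' j) => jS jg; rewrite {1}(hb_expand hbB jS); apply: eq_bigr => k _.
rewrite /env_term; case: eqP => [_|/eqP kj] /=; last by rewrite (hb_supp gW hbB jS jg).
rewrite nth_cat -s0 ltnNge leq_addr /= addKn (nth_map (j, k)) ?nth_enum_rank //.
by rewrite -cardE.
Qed.

Lemma wm_iso :
  (forall h, GRing.rterm h ->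
    (forall x, (forall j, x j \in SA /\ x j \in grV (g j)) ->
       GRing.eval (trace_env trace_words mulV eA x) h = 0) <->
    (forall x, (forall j, x j \in SB /\ x j \in grW (g j)) ->
       GRing.eval (trace_env trace_words mulW eB x) h = 0)) ->
  graded_iso mulV grV mulW grW SA SB.
Proof.
move=> same.
pose X := {x : 'I_d -> V | forall j, x j \in (SA :&: grV (g j))%VS}.
pose Y := {x : 'I_d -> W | forall j, x j \in (SB :&: grW (g j))%VS}.
pose EX (x : X) := trace_env trace_words mulV eA (proj1_sig x).
pose EY (y : Y) := trace_env trace_words mulW eB (proj1_sig y).
have x0 : X by exists (fun=> 0) => j; apply: mem0v.
have polyA n : poly_on_lines (fun x : 'I_d -> V => (trace_env trace_words mulV eA x)`_n).
  exact: (poly_on_lines_trace_env gV).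
(* Stated for any [phi] polynomial on lines, to cover the Gram determinant besides terms in the
   traces. *)
have irr phi h1 : poly_on_lines phi -> GRing.rterm h1 ->
    (exists x : X, phi (proj1_sig x) != 0) -> (exists x, GRing.eval (EX x) h1 != 0) ->
    exists x : X, phi (proj1_sig x) != 0 /\ GRing.eval (EX x) h1 != 0.
  move=> pphi r1 [[x xM] /= px] [[z zM] /= pz].
  have [||y yM py] := nonvanishing_both (M := fun j => (SA :&: grV (g j))%VS) pphi
     (poly_on_lines_eval polyA r1).
  - by exists x.
  - by exists z.
  by exists (exist _ y yM).
have [psi [qf rf psiE]] := closed_field_qe rformula_trace_formula.
have XY h : GRing.rterm h -> (exists x, GRing.eval (EX x) h != 0) ->
    exists y, GRing.eval (EY y) h != 0.
  move=> rh [x nz]; apply: NNPP => none; case/negP: nz; apply/eqP.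
  apply: (same h rh).2 => [z zP|j]; last exact/memv_capP/(proj2_sig x).
  have zM j : z j \in (SB :&: grW (g j))%VS by apply/memv_capP.
  apply/eqP; apply: contraT => nz.
  by case: none; exists (exist (fun x : 'I_d -> W => forall j, x j \in (SB :&: grW (g j))%VS) z zM).
have YX h : GRing.rterm h -> (exists y, GRing.eval (EY y) h != 0) ->
    exists x, GRing.eval (EX x) h != 0.
  move=> rh [x nz]; apply: NNPP => none; case/negP: nz; apply/eqP.
  apply: (same h rh).1 => [z zP|j]; last exact/memv_capP/(proj2_sig x).
  have zM j : z j \in (SA :&: grV (g j))%VS by apply/memv_capP.
  apply/eqP; apply: contraT => nz.
  by case: none; exists (exist (fun x : 'I_d -> V => forall j, x j \in (SA :&: grV (g j))%VS) z zM).
have irr2 h1 h2 (r1 : GRing.rterm h1) (r2 : GRing.rterm h2) :=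
  irr _ h2 (poly_on_lines_eval polyA r1) r2.
have [h [rh nzh [tv [tX tY]]]] := generic_truth x0 irr2 YX qf rf.
(* Some point of [Y] has [h] nonzero, and its trace tuple satisfies the formula by construction, so
   the common generic truth value is [true]. *)
have tvT : tv = true.
  have [[y yM] ny] := XY h rh nzh; rewrite -(tY _ ny); apply/psiE/trace_formulaP.
    by rewrite size_map.
  by exists y => // j; apply/memv_capP.
have pdet : poly_on_lines (fun x => \det (gram mulV eA x)).
  apply: poly_on_lines_det => i j x z.
  have [p pE] := poly_on_lines_trace gV eA [:: i; j] x z.
  by exists p => a; rewrite mxE pE.
(* The basis [eA] has nonzero Gram determinant, so some point of [X] has both this determinant and
   [h] nonzero. Its traces then satisfy the formula, that is, come from a tuple in [SB]. *)
have [|[x xM] [/= xdet xh]] := irr _ h pdet rh _ nzh.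
  have eM j : eA j \in (SA :&: grV (g j))%VS.
    by rewrite memv_cap (hb_mem hbA) (hb_gr hbA).
  exists (exist _ eA eM) => /=.
  have := gram_unit charF gV WMA hbA; rewrite unitmxE unitfE.
  by congr (is_true (\det _ != 0)); apply/matrixP=> i j; rewrite !mxE.
have /psiE/trace_formulaP[|x' xP' envE] : GRing.qf_eval (trace_env trace_words mulV eA x) psi.
  by have := tX (exist _ x xM) xh; rewrite tvT.
  by rewrite size_map.
apply: (iso_of_traces _ xP' envE xdet) => j.
exact/memv_capP.
Qed.

End Isomorphism.

Lemma hbasis_reindex (F : fieldType) (gT : finGroupType) (V : vectType F)
    (gr : gT -> {vspace V}) M d d' (g : 'I_d -> gT) (e : 'I_d -> V) (g' : 'I_d' -> gT) :
  hbasis gr M g e ->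
  (forall h, #|[pred k | g k == h]| = #|[pred k | g' k == h]|) ->
  exists p : 'I_d' -> 'I_d, hbasis gr M g' (fun k => e (p k)).
Proof.
move=> [eg eb] cnt.
have pgg : perm_eq [tuple g k | k < d] [tuple g' k | k < d'].
  apply/allP => h _ /=; apply/eqP.
  have E n (f : 'I_n -> gT) : count_mem h [seq f k | k <- enum 'I_n] = #|[pred k | f k == h]|.
    rewrite count_map -size_filter cardE; congr size.
    by rewrite [RHS]/enum_mem -enumT; apply: eq_filter.
  by rewrite !E.
have dd : d = d' by have := perm_size pgg; rewrite !size_tuple.
subst d'; move: pgg; rewrite perm_sym => /tuple_permP[p pE].
have gp k : g' k = g (p k).
  have {}pE := val_inj pE.
  by have := congr1 (fun t => tnth t k) pE; rewrite !tnth_mktuple.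
exists p; split=> [k|]; first by rewrite gp.
rewrite -(perm_basis _ (X := [tuple e k | k < d])) //.
rewrite perm_sym; apply/tuple_permP; exists p; congr tval.
by apply: eq_from_tnth => k; rewrite !tnth_mktuple.
Qed.

Theorem theorem4p4 (F : closedFieldType) (gT : finGroupType)
  (V W : vectType F) (mulV : V -> V -> V) (mulW : W -> W -> W)
  (grV : gT -> {vspace V}) (grW : gT -> {vspace W})
  (JA : {vspace V}) (JB : {vspace W}) (qA qB : nat)
  (Ai : 'I_qA -> {vspace V}) (Bi : 'I_qB -> {vspace W}) :
  [pchar F] =i pred0 ->
  galg mulV grV -> galg mulW grW ->
  graded_WM mulV grV JA Ai -> graded_WM mulW grW JB Bi ->
  full mulV JA Ai -> full mulW JB Bi ->
  (forall p : gpoly F gT, is_gid mulV grV p <-> is_gid mulW grW p) ->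
  graded_iso mulV grV mulW grW (\sum_(i < qA) Ai i)%VS (\sum_(i < qB) Bi i)%VS.
Proof.
move=> charF gV gW WMA WMB fullA fullB ids.
have idVW p : is_gid mulV grV p -> is_gid mulW grW p by move/ids.
have idWV p : is_gid mulW grW p -> is_gid mulV grV p by move/ids.
have dA : directv (\sum_(i < qA) Ai i) by case: WMA.
have dB : directv (\sum_(i < qB) Bi i) by case: WMB.
have [d [g [eA [ixA [hbA eixA]]]]] := hbasis_sum gV (Ai_graded WMA) dA.
have [d' [g' [eB [ixB [hbB eixB]]]]] := hbasis_sum gW (Ai_graded WMB) dB.
have cnt h : #|[pred k | g' k == h]| = #|[pred k | g k == h]|.
  apply/eqP; rewrite eqn_leq.
  rewrite (degree_count_le charF gV gW WMA WMB fullB idVW hbB eixB h hbA).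
  exact: (degree_count_le charF gW gV WMB WMA fullA idWV hbA eixA h hbB).
(* The basis of the second algebra is reordered to have the degrees [g] of the first, so both share
   the same alternating blocks and trace words. *)
have [p hbB'] := hbasis_reindex hbB cnt.
apply: (wm_iso charF gV gW WMA WMB hbA hbB') => h rh; split.
  apply: (trace_transfer charF gV gW WMA WMB fullB idVW hbB' (ix := fun k => ixB (p k)) _ hbA) => //.
  - by move=> w; apply: trace_words_neq0.
  - by move=> w; apply: trace_words_deg.
apply: (trace_transfer charF gW gV WMB WMA fullA idWV hbA eixA hbB') => //.
- by move=> w; apply: trace_words_neq0.
by move=> w; apply: trace_words_deg.
Qed.
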